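(* Let $\psi$ be a measurable function on $\mathbb R^n$ and let $T_\psi$ be the multiplier operator $T_\psi(f)=f\psi$. Then: (A) $T_\psi$ is a bounded operator in $BMO_{\mathcal L}$ if and only if $\psi\in L^\infty(\mathbb R^n)$ and there exists $C>0$ such that, for all balls $B=B(x_0,s)$ with $0<s<\frac12\rho(x_0)$, $$\log\left(\frac{\rho(x_0)}s\right)\frac1{|B|}\int_B|\psi(y)-\psi_B|\,dy\le C.$$ (B) For $0<\alpha<1$, $T_\psi$ is a bounded operator in $BMO^\alpha_{\mathcal L}$ if and only if $\psi\in L^\infty(\mathbb R^n)$ and there exists $C>0$ such that, for all balls $B=B(x_0,s)$ with $0<s<\frac12\rho(x_0)$, $$\left(\frac{\rho(x_0)}s\right)^\alpha\frac1{|B|}\int_B|\psi(y)-\psi_B|\,dy\le C.$$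
   Context: $n\ge 3$ and $\mathcal L=-\Delta+V$ on $\mathbb R^n$, where $V\ge 0$ is a locally integrable, not identically zero function satisfying a reverse Hölder inequality $V\in RH_q$ for some $q\ge n/2$: there is a constant $C$ with $\left(\frac1{|B|}\int_B V^q\right)^{1/q}\le \frac{C}{|B|}\int_B V$ for all balls $B\subset\mathbb R^n$. The critical radii function is $\rho(x)=\sup\{r>0:\ r^{-(n-2)}\int_{B(x,r)}V(y)\,dy\le 1\}$; it satisfies $0<\rho(x)<\infty$. For a ball $B$, $f_B=\frac1{|B|}\int_B f$. For $0\le\alpha\le1$, a locally integrable function $f$ belongs to $BMO^\alpha_{\mathcal L}$ if there is $C>0$ such that (i) $\frac1{|B|}\int_B|f-f_B|\le C|B|^{\alpha/n}$ for every ball $B\subset\mathbb R^n$, and (ii) $\frac1{|B|}\int_B|f|\le C|B|^{\alpha/n}$ for every ball $B=B(x_0,r_0)$ with $r_0\ge\rho(x_0)$. The norm is the minimum such $C$, and $BMO_{\mathcal L}=BMO^0_{\mathcal L}$. *)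

(* Defs.v *)
From HB Require Import structures.
From mathcomp Require Import all_boot all_order all_algebra.
From mathcomp Require Import all_classical all_reals all_analysis.

Set Implicit Arguments.
Unset Strict Implicit.
Unset Printing Implicit Defensive.
Import Order.TTheory GRing.Theory Num.Theory.
Import numFieldNormedType.Exports.

Local Open Scope classical_set_scope.
Local Open Scope ring_scope.

Section borel_lebesgue_measure.
Context {R : realType}.
Local Notation mR := (measurableTypeR R).

Definition tcons n (p : mR * n.-tuple mR) : n.+1.-tuple mR :=
  [tuple of p.1 :: p.2].

Lemma measurable_tcons n : measurable_fun [set: _] (@tcons n).
Proof. exact: measurable_cons measurable_fst measurable_snd. Qed.

Lemma preimage_tcons n (A : set mR) (B : set (n.-tuple mR)) :
  @tcons n @^-1` [set t | A (thead t) /\ B [tuple of behead t]] = A `*` B.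
Proof.
apply/seteqP.
by split=> -[x t] /=; rewrite theadE (_ : [tuple of _] = t)//; exact/val_inj.
Qed.

Section prod_leb.
Variables (n : nat) (m : {sigma_finite_measure set (n.-tuple mR) -> \bar R}).

Definition prod_leb : set (n.+1.-tuple mR) -> \bar R :=
  pushforward (lebesgue_measure \x m)%E (@tcons n).

Let measurable_preimage_tcons (A : set (n.+1.-tuple mR)) :
  measurable A -> measurable (@tcons n @^-1` A).
Proof.
by move=> mA; rewrite -[X in measurable X]setTI; exact: measurable_tcons.
Qed.

Let prod_leb0 : prod_leb set0 = 0%E.
Proof. by rewrite /prod_leb /pushforward preimage_set0 measure0. Qed.

Let prod_leb_ge0 A : (0 <= prod_leb A)%E.
Proof. exact: (measure_ge0 (lebesgue_measure \x m)%E). Qed.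

Let prod_leb_sigma_additive : semi_sigma_additive prod_leb.
Proof.
move=> F mF tF mUF; rewrite /prod_leb /pushforward preimage_bigcup.
apply: measure_semi_sigma_additive.
- by move=> k; exact: measurable_preimage_tcons.
- apply/trivIsetP => i j _ _ ij; rewrite -preimage_setI.
  by move/trivIsetP : tF => ->//; rewrite preimage_set0.
- by rewrite -preimage_bigcup; exact: measurable_preimage_tcons.
Qed.

HB.instance Definition _ := isMeasure.Build _ _ _ prod_leb
  prod_leb0 prod_leb_ge0 prod_leb_sigma_additive.

Let prod_leb_sigma_finite : sigma_finite setT prod_leb.
Proof.
have /sigma_finiteP[F [TF ndF Foo]] := sigma_finiteT (@lebesgue_measure R).
have /sigma_finiteP[G [TG ndG Goo]] := sigma_finiteT m.
exists (fun k => [set t | F k (thead t) /\ G k [tuple of behead t]]) => [|k].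
  apply/seteqP; split=> // t _.
  have [k _ Fk] : (\bigcup_i F i) (thead t) by rewrite -TF.
  have [l _ Gl] : (\bigcup_i G i) [tuple of behead t] by rewrite -TG.
  exists (maxn k l) => //; split.
  - by move: Fk; exact/subsetPset/ndF/leq_maxl.
  - by move: Gl; exact/subsetPset/ndG/leq_maxr.
have [mF Fk] := Foo k; have [mG Gk] := Goo k; split.
  have mhead : measurable ((fun t : n.+1.-tuple mR => thead t) @^-1` F k).
    rewrite -[X in measurable X]setTI.
    exact: (@measurable_tnth _ mR n.+1 ord0).
  have mtail :
      measurable ((fun t : n.+1.-tuple mR => [tuple of behead t]) @^-1` G k).
    by rewrite -[X in measurable X]setTI; exact: measurable_behead.
  exact: measurableI.
rewrite /prod_leb /pushforward preimage_tcons product_measure1E//.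
by rewrite lte_mul_pinfty// ge0_fin_numE.
Qed.

HB.instance Definition _ := @Measure_isSigmaFinite.Build _ _ _ prod_leb
  prod_leb_sigma_finite.

End prod_leb.

Fixpoint borel_leb n : {sigma_finite_measure set (n.-tuple mR) -> \bar R} :=
  match n with
  | 0 => @dirac _ _ [tuple] R
  | n'.+1 => prod_leb (borel_leb n')
  end.

Lemma measurable_box n (A : 'I_n -> set mR) : (forall i, measurable (A i)) ->
  measurable [set t : n.-tuple mR | forall i, A i (tnth t i)].
Proof.
move=> mA; rewrite (_ : [set t | _] =
  \bigcap_(i in [set: 'I_n]) ((fun t : n.-tuple mR => tnth t i) @^-1` A i)).
  apply: fin_bigcap_measurable => // i _.
  by rewrite -[X in measurable X]setTI; exact: measurable_tnth.
by apply/seteqP; split=> [t tA i _|t tA i]; exact: tA.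
Qed.

Lemma borel_leb_box n (A : 'I_n -> set mR) : (forall i, measurable (A i)) ->
  borel_leb n [set t | forall i, A i (tnth t i)] =
  (\prod_(i < n) lebesgue_measure (A i))%E.
Proof.
elim: n A => [|n IHn] A mA.
  by rewrite big_ord0 /= diracE mem_set//; case.
rewrite big_ord_recl -(IHn (fun i => A (lift ord0 i)))// -product_measure1E//.
  rewrite -preimage_tcons; congr (pushforward _ _ _).
  have tnth_tail (t : n.+1.-tuple mR) i :
      tnth [tuple of behead t] i = tnth t (lift ord0 i).
    rewrite tnth_behead; congr tnth; apply/val_inj.
    by rewrite /= inordK// ltnS.
  apply/seteqP; split=> [t tA|t [tA0 tA] i].
    by split=> [|i]; [exact: tA|rewrite tnth_tail; exact: tA].
  by case: (unliftP ord0 i) => [j|] ->//; rewrite -tnth_tail; exact: tA.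
exact: (measurable_box (fun i => mA (lift ord0 i))).
Qed.

End borel_lebesgue_measure.

(* R^n with the sigma-algebra of Lebesgue measurable sets; the underlying type
   is n.-tuple R. *)
Definition Rn (R : realType) (n : nat) :=
  caratheodory_type (borel_leb (R := R) n)^*%mu.

Section bmo.
Context {R : realType} {n : nat}.
Local Notation Rn := (Rn R n).

Definition leb : set Rn -> \bar R :=
  @completed_measure_extension _ _ R (borel_leb n).

HB.instance Definition _ := Measure.on leb.

Lemma leb_box (A : 'I_n -> set (measurableTypeR R)) :
  (forall i, measurable (A i)) ->
  leb [set t | forall i, A i (tnth t i)] =
  (\prod_(i < n) lebesgue_measure (A i))%E.
Proof.
move=> mA; rewrite -borel_leb_box// /leb /completed_measure_extension.
by rewrite measurable_mu_extE//; exact: measurable_box.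
Qed.

Definition edist (x y : n.-tuple R) : R :=
  Num.sqrt (\sum_(i < n) (tnth x i - tnth y i) ^+ 2).

Definition eball (x : Rn) (r : R) : set Rn := [set y | edist x y < r].

Definition loc_integrable (f : Rn -> R) :=
  measurable_fun [set: Rn] f /\
  forall x r, leb.-integrable (eball x r) (EFin \o f).

Definition eavg (B : set Rn) (f : Rn -> R) : \bar R :=
  ((leb B)^-1 * \int[leb]_(y in B) (f y)%:E)%E.

Definition avg (B : set Rn) (f : Rn -> R) : R := fine (eavg B f).

Definition osc (B : set Rn) (f : Rn -> R) : \bar R :=
  eavg B (fun y => `|f y - avg B f|).

(* Stated in the extended reals, so that V ^ q is forced to be locally
   integrable rather than receiving a junk average. *)
Definition reverse_holder (q : R) (V : Rn -> R) := exists C : R,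
  forall x r, 0 < r ->
  (eavg (eball x r) (fun y => (V y `^ q)%R) `^ q^-1 <= C%:E * eavg (eball x r) V)%E.

(* The supremum is taken in R, where sup is 0 on unbounded sets; this is
   harmless for the V under consideration, whose critical radii are finite. *)
Definition critical_radius (V : Rn -> R) (x : Rn) : R :=
  sup [set r | 0 < r /\
    ((r ^- (n - 2))%:E * \int[leb]_(y in eball x r) (V y)%:E <= 1)%E].

(* C is admissible in both conditions defining BMO^alpha_L; the operator
   L = - Laplacian + V enters only through its critical radii. *)
Definition bmo_bound (V : Rn -> R) (alpha : R) (f : Rn -> R) (C : R) :=
  (forall x r, 0 < r ->
     (osc (eball x r) f <= C%:E * leb (eball x r) `^ (alpha / n%:R))%E) /\
  (forall x r, 0 < r -> critical_radius V x <= r ->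
     (eavg (eball x r) (fun y => `|f y|%R)
        <= C%:E * leb (eball x r) `^ (alpha / n%:R))%E).

Definition bmo (V : Rn -> R) (alpha : R) : set (Rn -> R) :=
  [set f | loc_integrable f /\ exists C, 0 < C /\ bmo_bound V alpha f C].

Definition bmo_norm (V : Rn -> R) (alpha : R) (f : Rn -> R) : R :=
  inf [set C | bmo_bound V alpha f C].

Definition multiplier (psi f : Rn -> R) : Rn -> R := fun x => f x * psi x.

Definition bounded_on_bmo (V : Rn -> R) (alpha : R)
    (T : (Rn -> R) -> (Rn -> R)) :=
  (forall f, bmo V alpha f -> bmo V alpha (T f)) /\
  exists M : R, forall f, bmo V alpha f ->
    bmo_norm V alpha (T f) <= M * bmo_norm V alpha f.

End bmo.
Arguments leb R n : clear implicits.

(* Main.v *)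
Require Import Defs.
From HB Require Import structures.
From mathcomp Require Import all_boot all_order all_algebra.
From mathcomp Require Import all_classical all_reals all_analysis.
From mathcomp Require Import measurable_realfun ess_sup_inf.
From mathcomp Require Import ring lra.
Set Implicit Arguments.
Unset Strict Implicit.
Unset Printing Implicit Defensive.
Import Order.TTheory GRing.Theory Num.Theory.
Import numFieldNormedType.Exports.
Local Open Scope classical_set_scope.
Local Open Scope ring_scope.

(** Write [rho] for the critical radius and [T] for multiplication by [psi].

Sufficiency.  On a ball [B] of radius [s < rho / 2] one has
[f psi - f_B psi_B = (f - f_B) psi + f_B (psi - psi_B)], so the oscillation of
[f psi] is at most that of [f] times the bound of [psi], plus [|f_B|] times the
oscillation of [psi].  Doubling [B] until it reaches the critical radius, where
the averages of [|f|] are controlled, shows that [|f_B|] is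
[O(log (rho / s))] when [alpha = 0] and [O(rho ^ alpha)] when [alpha > 0]
([log_gain], [power_gain]); the hypothesis on [psi] compensates exactly this
growth ([multiplier_bounded]).  Larger balls need only that [psi] is bounded.

Necessity.  That [psi] is bounded comes from iterating [T]: if [T] has norm
[M], then [T ^ m] has norm at most [M ^ m], so that for a function [f] which is
constant on a large ball the averages of [|psi| ^ m] over it are [O(M ^ m)] for
every [m], and [|psi| <= M + 1] there by Chebyshev's inequality
([multiplier_ess_bounded]).  The oscillation condition comes from testing [T]
on functions with bounded norm which take a large constant value [h] on the
ball: then [h] times the oscillation of [psi] is the oscillation of [T f].  For
[alpha > 0] a plateau of width comparable to [rho] and height [rho ^ alpha]
will do; for [alpha = 0] one piles up plateaus over all dyadic scales between
[s] and [rho], a discrete logarithm of height about [log (rho / s)].  Its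
oscillation stays bounded because a plateau of width [t] oscillates over a ball
of radius [r] by only [O(min (t / r, r / t))] ([mosc_plateau]), which is
summable over dyadic [t].

The potential enters through [rho] alone.  Test functions have to obey the
average condition on every ball whose radius exceeds its own critical radius,
so one needs that [rho] at points near [x] is not much smaller than at [x]
([critical_radius_clear]), and that it is locally bounded below
([critical_radius_lb]).  Both follow from the uniform decay of the
scale-invariant quantity [r ^ (2 - n) * \int_(B(x, r)) V] at small scales
([Phi_decay]).  For [q > n / 2] this is Hoelder's inequality; to include
[q = n / 2] one also uses that the mass of [V ^ q] in a small concentric ball
is at most a fixed fraction of its mass in the large one ([RH_shrink]), which
the reverse Hoelder inequality forces. *)

Local Notation edist := Defs.edist.

(** * Euclidean balls and their volume *)

Section euclidean_balls.
Context {R : realType} {n : nat}.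
Local Notation Rn := (Rn R n).
Local Notation mu := (leb R n).
Implicit Types (x y z : Rn) (r s : R).

Lemma edist_ge0 x y : 0 <= edist x y.
Proof. exact: sqrtr_ge0. Qed.

Lemma edistxx x : edist x x = 0.
Proof.
by rewrite /edist big1 ?sqrtr0// => i _; rewrite subrr expr0n.
Qed.

Lemma edistC x y : edist x y = edist y x.
Proof.
by rewrite /edist; congr Num.sqrt; apply: eq_bigr => i _; rewrite -sqrrN opprB.
Qed.

Lemma cauchy_schwarz (a b : 'I_n -> R) :
  \sum_i a i * b i <=
  Num.sqrt (\sum_i a i ^+ 2) * Num.sqrt (\sum_i b i ^+ 2).
Proof.
set P := Num.sqrt _; set Q := Num.sqrt _.
have P0 : 0 <= P by exact: sqrtr_ge0.
have Q0 : 0 <= Q by exact: sqrtr_ge0.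
have P2 : \sum_i a i ^+ 2 = P ^+ 2.
  by rewrite sqr_sqrtr// sumr_ge0// => i _; exact: sqr_ge0.
have Q2 : \sum_i b i ^+ 2 = Q ^+ 2.
  by rewrite sqr_sqrtr// sumr_ge0// => i _; exact: sqr_ge0.
have zero (c : 'I_n -> R) : \sum_i c i ^+ 2 = 0 -> forall i, c i = 0.
  move=> /eqP; rewrite psumr_eq0; last by move=> i _; exact: sqr_ge0.
  by move=> /allP c0 i; move: (c0 i); rewrite mem_index_enum sqrf_eq0 => /(_ isT)/eqP.
have [P00|Pn0] := eqVneq P 0.
  by rewrite P00 mul0r big1// => i _; rewrite zero ?mul0r// P2 P00 expr0n.
have [Q00|Qn0] := eqVneq Q 0.
  by rewrite Q00 mulr0 big1// => i _; rewrite (zero b) ?mulr0// Q2 Q00 expr0n.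
have : 0 <= \sum_i (Q * a i - P * b i) ^+ 2.
  by apply: sumr_ge0 => i _; exact: sqr_ge0.
have -> : \sum_i (Q * a i - P * b i) ^+ 2 =
    Q ^+ 2 * \sum_i a i ^+ 2 - 2 * (P * Q) * (\sum_i a i * b i)
      + P ^+ 2 * \sum_i b i ^+ 2.
  rewrite !mulr_sumr -sumrN -!big_split /=.
  by apply: eq_bigr => i _; ring.
rewrite P2 Q2.
have PQ : 0 < P * Q by rewrite mulr_gt0// lt0r ?Pn0 ?Qn0.
move=> h; rewrite -(ler_pM2l PQ); nra.
Qed.

Lemma edist_triangle y x z : edist x z <= edist x y + edist y z.
Proof.
rewrite -[leRHS]ger0_norm ?addr_ge0 ?edist_ge0// -sqrtr_sqr ler_wsqrtr//.
rewrite sqrrD /edist !sqr_sqrtr; last 2 first.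
- by apply: sumr_ge0 => i _; exact: sqr_ge0.
- by apply: sumr_ge0 => i _; exact: sqr_ge0.
have := cauchy_schwarz (fun i => tnth x i - tnth y i)
  (fun i => tnth y i - tnth z i).
set S := (X in X <= _) => h.
rewrite (_ : \sum_i _ = \sum_i (tnth x i - tnth y i) ^+ 2 + 2 * S
   + \sum_i (tnth y i - tnth z i) ^+ 2); first by nra.
rewrite /S mulr_sumr -!big_split/=; apply: eq_bigr => i _; ring.
Qed.

Lemma le_coord_edist x y i : `|tnth x i - tnth y i| <= edist x y.
Proof.
rewrite -sqrtr_sqr ler_wsqrtr// (bigD1 i)//= lerDl.
by apply: sumr_ge0 => j _; exact: sqr_ge0.
Qed.

Lemma eball_le0 x r : r <= 0 -> eball x r = set0.
Proof.
move=> r0; apply/seteqP; split=> // y xy.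
have : edist x y < r := xy.
by rewrite ltNge (le_trans r0)// edist_ge0.
Qed.

Lemma sub_eball {x y r s} : edist x y + s <= r -> eball y s `<=` eball x r.
Proof.
move=> h z /= yz; apply: le_lt_trans (edist_triangle y x z) _.
by apply: lt_le_trans h; rewrite ltrD2l.
Qed.

Lemma measurable_borel_tuple (A : set (n.-tuple (measurableTypeR R))) :
  measurable A -> measurable (A : set Rn).
Proof.
by move=> mA; apply: sub_caratheodory; exact: sub_sigma_algebra.
Qed.

Lemma measurable_edist x : measurable_fun [set: Rn] (edist x).
Proof.
pose g (t : n.-tuple (measurableTypeR R)) :=
  \sum_(i < n) (tnth x i - tnth t i) ^+ 2.
have mg : measurable_fun setT g.
  apply: measurable_sum => i; apply: measurable_funX.
  by apply: measurable_funB => //; exact: measurable_tnth.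
have ms : measurable_fun setT (Num.sqrt : R -> R).
  apply: continuous_measurable_fun.
  exact: sqrt_continuous.
have mt := measurableT_comp ms mg.
move=> _ B mB; rewrite setTI; apply: measurable_borel_tuple.
by rewrite -[X in measurable X]setTI; exact: mt.
Qed.

Lemma measurable_eball x r : measurable (eball x r).
Proof.
rewrite (_ : eball x r = [set: Rn] `&` edist x @^-1` `]-oo, r[).
  by apply: measurable_edist => //; exact: measurable_itv.
by apply/seteqP; split => z /=; rewrite in_itv//= => -[].
Qed.

Let cube x r : set Rn :=
  [set t | forall i, `]tnth x i - r, tnth x i + r[%classic (tnth t i)].

Let measurable_cube x r : measurable (cube x r).
Proof.
apply: measurable_borel_tuple.
by apply: (@measurable_box R n (fun i => `]tnth x i - r, tnth x i + r[%classic)).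
Qed.

Let leb_cube x r : 0 < r -> mu (cube x r) = ((2 * r) ^+ n)%:E.
Proof.
move=> r0; rewrite (leb_box (A := fun i => `]tnth x i - r, tnth x i + r[%classic))//.
under eq_bigr => i _.
  rewrite lebesgue_measure_itv/= lte_fin ltrBlDr -addrA ltrDl addr_gt0//.
  rewrite -EFinB (_ : _ - _ = 2 * r); last by ring.
  over.
rewrite prodEFin; congr EFin.
by rewrite prodr_const card_ord.
Qed.

(** Only the order of magnitude of the volume matters below, so a ball is
merely compared with a cube inside it and a cube around it. *)
Lemma leb_eball_le x r : 0 < r -> (mu (eball x r) <= ((2 * r) ^+ n)%:E)%E.
Proof.
move=> r0; rewrite -(leb_cube x r0); apply: le_measure.
- by rewrite inE; exact: measurable_eball.
- by rewrite inE; exact: measurable_cube.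
- move=> z /= xz i /=; rewrite in_itv/= -ltr_distl distrC.
  exact: le_lt_trans (le_coord_edist _ _ _) xz.
Qed.

Lemma leb_eball_ge x r : 0 < r ->
  (((2 * (r / n.+1%:R)) ^+ n)%:E <= mu (eball x r))%E.
Proof.
move=> r0; have r'0 : 0 < r / n.+1%:R by rewrite divr_gt0.
rewrite -(leb_cube x r'0); apply: le_measure.
- by rewrite inE; exact: measurable_cube.
- by rewrite inE; exact: measurable_eball.
move=> z /= xz; rewrite /eball/= -[ltRHS]ger0_norm ?ltW// -sqrtr_sqr ltr_sqrt ?exprn_gt0//.
apply: (@le_lt_trans _ _ (\sum_(i < n) (r / n.+1%:R) ^+ 2)).
  apply: ler_sum => i _; rewrite -real_normK ?num_real// ler_sqr ?nnegrE//; last exact: ltW.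
  by rewrite distrC ltW// ltr_distl; have := xz i; rewrite /= in_itv.
rewrite sumr_const card_ord -[X in X < _]mulr_natl exprMn exprVn.
rewrite mulrCA gtr_pMr ?exprn_gt0// ltr_pdivrMr ?exprn_gt0// mul1r -natrX ltr_nat.
by rewrite -mulnn (leq_trans (ltnSn n))// leq_pmulr.
Qed.

End euclidean_balls.

(** * Averages and mean oscillations over balls *)

(** A sealed copy of [loc_integrable], so that comparing two instances never
unfolds the integrals inside. *)
HB.lock Definition locint {R : realType} {n : nat} (f : Rn R n -> R) : Prop :=
  loc_integrable f.

Section averages.
Context {R : realType} {n : nat}.
Local Notation Rn := (Rn R n).
Local Notation mu := (leb R n).
Implicit Types (x y z : Rn) (r s : R) (f g : Rn -> R).

Definition vol x r : R := fine (mu (eball x r)).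

Lemma leb_eballE x r : 0 < r -> mu (eball x r) = (vol x r)%:E.
Proof.
move=> r0; rewrite /vol fineK// ge0_fin_numE//.
by rewrite (le_lt_trans (leb_eball_le x r0))// ltry.
Qed.

Lemma vol_le x r : 0 < r -> vol x r <= (2 * r) ^+ n.
Proof. by move=> r0; rewrite -lee_fin -leb_eballE// leb_eball_le. Qed.

Lemma vol_ge x r : 0 < r -> (2 * (r / n.+1%:R)) ^+ n <= vol x r.
Proof. by move=> r0; rewrite -lee_fin -leb_eballE// leb_eball_ge. Qed.

Lemma vol_gt0 x r : 0 < r -> 0 < vol x r.
Proof.
move=> r0; apply: lt_le_trans (vol_ge x r0).
by rewrite exprn_gt0// mulr_gt0// divr_gt0.
Qed.

Lemma vol_ratio x r y s : 0 < r -> 0 < s ->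
  vol x r <= (n.+1%:R * (r / s)) ^+ n * vol y s.
Proof.
move=> r0 s0; apply: le_trans (vol_le x r0) _.
apply: le_trans (ler_wpM2l _ (vol_ge y s0)); last first.
  by rewrite exprn_ge0// mulr_ge0// divr_ge0// ltW.
rewrite -exprMn (_ : n.+1%:R * (r / s) * (2 * (s / n.+1%:R)) = 2 * r)//.
by field; rewrite nat1r pnatr_eq0 (gt_eqF s0).
Qed.

Lemma eavg_ballE x r f : 0 < r ->
  eavg (eball x r) f = ((vol x r)^-1%:E * \int[mu]_(y in eball x r) (f y)%:E)%E.
Proof.
move=> r0; rewrite /eavg leb_eballE// inver gt_eqF//.
exact: vol_gt0.
Qed.

Lemma locintP f : loc_integrable f <-> locint f.
Proof. by rewrite locint.unlock. Qed.

Lemma LocInt f : measurable_fun [set: Rn] f ->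
  (forall x r, mu.-integrable (eball x r) (EFin \o f)) -> locint f.
Proof. by move=> mf If; apply/locintP; split; [exact: mf|exact: If]. Qed.

Lemma locint_measurable f : locint f -> measurable_fun [set: Rn] f.
Proof. by move/locintP; case. Qed.

Lemma locint_ball f : locint f ->
  forall x r, mu.-integrable (eball x r) (EFin \o f).
Proof. by move/locintP; case. Qed.

Lemma locint_dom f (h : Rn -> R) : locint f ->
  measurable_fun [set: Rn] h -> {ae mu, forall x, `|h x| <= `|f x|} ->
  locint h.
Proof.
move=> If mh hf; have mf := locint_measurable If.
apply: LocInt => [//|x r].
have mhr : measurable_fun (eball x r) (EFin \o h).
  by apply/measurable_EFinP; exact: measurable_funTS.
apply/integrableP; split; first exact: mhr.
have /integrableP[mfr] := locint_ball If x r; apply: le_lt_trans.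
apply: ae_ge0_le_integral.
- exact: measurable_eball.
- by move=> y _; exact: abse_ge0.
- exact: (measurableT_comp (@abse_measurable _ setT) mhr).
- by move=> y _; exact: abse_ge0.
- exact: (measurableT_comp (@abse_measurable _ setT) mfr).
- by apply: filterS hf => y hy _ /=; rewrite lee_fin.
Qed.

Lemma locint_cst (c : R) : locint (fun _ : Rn => c).
Proof.
apply: LocInt => [|x r]; first exact: measurable_cst.
have [r0|r0] := ltP 0 r.
  apply: measurable_bounded_integrable; first exact: measurable_eball.
  - exact: le_lt_trans (leb_eball_le x r0) (ltry _).
  - exact: measurable_cst.
  - exact: bounded_cst.
by rewrite eball_le0//; exact: integrable_set0.
Qed.

Lemma locintD f g : locint f -> locint g ->
  locint (fun x => f x + g x).
Proof.
move=> If Ig; apply: LocInt => [|x r].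
  by apply: measurable_funD; exact: locint_measurable.
have := integrableD (measurable_eball x r) (locint_ball If x r)
  (locint_ball Ig x r).
exact.
Qed.

Lemma locintZ (c : R) f : locint f ->
  locint (fun x => c * f x).
Proof.
move=> If; apply: LocInt => [|x r].
  by apply: measurable_funM; [exact: measurable_cst|exact: locint_measurable].
have := integrableZl (measurable_eball x r) c (locint_ball If x r).
exact.
Qed.

Lemma locintB f g : locint f -> locint g ->
  locint (fun x => f x - g x).
Proof.
move=> If Ig; rewrite (_ : (fun x => _) = (fun x => f x + (-1) * g x)).
  by apply: locintD => //; exact: locintZ.
by apply/funext => x; rewrite mulN1r.
Qed.

Lemma locint_norm f : locint f ->
  locint (fun x => `|f x|).
Proof.
move=> If; apply: (locint_dom If).
  exact: (measurableT_comp (@normr_measurable R setT) (locint_measurable If)).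
by apply: aeW => x; rewrite normr_id.
Qed.

Lemma locint_sum (I : Type) (s : seq I) (F : I -> Rn -> R) :
  (forall i, locint (F i)) ->
  locint (fun x => \sum_(i <- s) F i x).
Proof.
move=> IF; elim: s => [|i s IHs].
  rewrite (_ : (fun x => _) = (fun _ => 0)); first exact: locint_cst.
  by apply/funext => x; rewrite big_nil.
rewrite (_ : (fun x => _) = (fun x => F i x + \sum_(j <- s) F j x)).
  exact: locintD.
by apply/funext => x; rewrite big_cons.
Qed.

Lemma locint_bounded f (K : R) : measurable_fun [set: Rn] f ->
  {ae mu, forall x, `|f x| <= K} -> locint f.
Proof.
move=> mf fK; apply: (locint_dom (locint_cst K)); first exact: mf.
by apply: filterS fK => x /le_trans; apply; exact: ler_norm.
Qed.

Lemma locint_mul f (psi : Rn -> R) (K : R) : locint f ->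
  measurable_fun [set: Rn] psi -> {ae mu, forall x, `|psi x| <= K} ->
  locint (fun x => f x * psi x).
Proof.
move=> If mpsi psiK; apply: (locint_dom (locintZ K If)).
  by apply: measurable_funM; [exact: locint_measurable If|exact: mpsi].
apply: filterS psiK => x xK; rewrite !normrM mulrC ler_wpM2r//.
by apply: le_trans xK _; exact: ler_norm.
Qed.

Section on_a_ball.
Variables (x : Rn) (r : R).
Hypothesis r0 : 0 < r.
Local Notation B := (eball x r).

Let mB : measurable B. Proof. exact: measurable_eball. Qed.

Lemma avgE f : locint f ->
  avg B f = (vol x r)^-1 * \int[mu]_(y in B) f y.
Proof.
move=> If; rewrite /avg eavg_ballE// fineM//.
by apply: integrable_fin_num => //; exact: locint_ball.
Qed.

Lemma eavgE f : locint f -> eavg B f = (avg B f)%:E.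
Proof.
move=> If; rewrite /avg fineK// eavg_ballE// fin_numM//.
by apply: integrable_fin_num => //; exact: locint_ball.
Qed.

Lemma avg_cst (c : R) : avg B (fun=> c) = c.
Proof.
rewrite avgE; last exact: locint_cst.
by rewrite Rintegral_cst// mulrCA mulVf ?mulr1// gt_eqF// vol_gt0.
Qed.

Lemma avgD f g : locint f -> locint g ->
  avg B (fun y => f y + g y) = avg B f + avg B g.
Proof.
move=> If Ig; rewrite !avgE//; last exact: locintD.
by rewrite RintegralD// ?mulrDr//; exact: locint_ball.
Qed.

Lemma avgZ (c : R) f : locint f ->
  avg B (fun y => c * f y) = c * avg B f.
Proof.
move=> If; rewrite !avgE//; last exact: locintZ.
by rewrite RintegralZl// 1?mulrCA//; exact: locint_ball.
Qed.

Lemma avgB f g : locint f -> locint g ->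
  avg B (fun y => f y - g y) = avg B f - avg B g.
Proof.
move=> If Ig; rewrite (_ : (fun y => _) = (fun y => f y + (-1) * g y)).
  by rewrite avgD ?avgZ ?mulN1r//; exact: locintZ.
by apply/funext => y; rewrite mulN1r.
Qed.

Lemma avg_sum (I : Type) (s : seq I) (F : I -> Rn -> R) :
  (forall i, locint (F i)) ->
  avg B (fun y => \sum_(i <- s) F i y) = \sum_(i <- s) avg B (F i).
Proof.
move=> IF; elim: s => [|i s IHs].
  rewrite big_nil (_ : (fun y => _) = (fun _ => 0)) ?avg_cst//.
  by apply/funext => y; rewrite big_nil.
rewrite big_cons -IHs -avgD; [|exact: IF|exact: locint_sum].
by congr (avg _ _); apply/funext => y; rewrite big_cons.
Qed.

Lemma le_avg f g : locint f -> locint g ->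
  (forall y, B y -> f y <= g y) -> avg B f <= avg B g.
Proof.
move=> If Ig fg; rewrite !avgE// ler_pM2l ?invr_gt0 ?vol_gt0//.
by apply: le_Rintegral => //; exact: locint_ball.
Qed.

Lemma le_avg_ae f g : locint f -> locint g ->
  (forall y, 0 <= f y) ->
  {ae mu, forall y, f y <= g y} -> avg B f <= avg B g.
Proof.
move=> If Ig f0 fg; rewrite !avgE// ler_pM2l ?invr_gt0 ?vol_gt0//.
have mf := locint_measurable If.
have mg := locint_measurable Ig.
apply: fine_le.
- by apply: integrable_fin_num => //; exact: locint_ball.
- by apply: integrable_fin_num => //; exact: locint_ball.
have mfB : measurable_fun B (EFin \o f).
  by apply/measurable_EFinP; exact: measurable_funTS.
have mgB : measurable_fun B (EFin \o g).
  by apply/measurable_EFinP; exact: measurable_funTS.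
have mngB : measurable_fun B (fun y => `|g y|%:E).
  exact: (measurableT_comp (@abse_measurable R setT) mgB).
rewrite (_ : (\int[mu]_(y in B) (g y)%:E = \int[mu]_(y in B) `|g y|%:E)%E).
  apply: ae_ge0_le_integral.
  - exact: mB.
  - by move=> y _; rewrite lee_fin.
  - exact: mfB.
  - by move=> y _; rewrite lee_fin.
  - exact: mngB.
  - apply: filterS fg => y fy _; rewrite lee_fin.
    exact: le_trans fy (ler_norm _).
apply: ae_eq_integral.
- exact: mB.
- exact: mgB.
- exact: mngB.
- apply: filterS fg => y fy _ /=; rewrite ger0_norm//.
  exact: le_trans (f0 y) fy.
Qed.

Lemma avg_ge0 f : (forall y, B y -> 0 <= f y) -> 0 <= avg B f.
Proof.
move=> f0; rewrite /avg fine_ge0// eavg_ballE// mule_ge0//.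
  by rewrite lee_fin invr_ge0 ltW// vol_gt0.
by apply: integral_ge0 => y By; rewrite lee_fin f0.
Qed.

Lemma eq_avg f g : (forall y, B y -> f y = g y) -> avg B f = avg B g.
Proof.
move=> fg; rewrite /avg /eavg; congr (fine (_ * _)).
by apply: eq_integral => y /set_mem By; rewrite fg.
Qed.

Lemma norm_avg f : locint f -> `|avg B f| <= avg B (fun y => `|f y|).
Proof.
move=> If; rewrite !avgE//; last exact: locint_norm.
rewrite normrM [X in X * _]ger0_norm; last by rewrite invr_ge0 ltW// vol_gt0.
rewrite ler_pM2l ?invr_gt0 ?vol_gt0// le_normr_Rintegral//.
exact: locint_ball.
Qed.

Definition mosc f : R := avg B (fun y => `|f y - avg B f|).

Lemma locint_dev f (c : R) : locint f ->
  locint (fun y => `|f y - c|).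
Proof.
move=> If; apply: locint_norm; apply: locintB => //.
exact: locint_cst.
Qed.

Lemma oscE f : locint f -> osc B f = (mosc f)%:E.
Proof. by move=> If; rewrite /osc eavgE//; exact: locint_dev. Qed.

Lemma mosc_ge0 f : 0 <= mosc f.
Proof. exact: avg_ge0. Qed.

Lemma norm_avg_sub f (c : R) : locint f ->
  `|avg B f - c| <= avg B (fun y => `|f y - c|).
Proof.
move=> If; rewrite -{1}(avg_cst c) -avgB//; last exact: locint_cst.
apply: norm_avg; apply: locintB => //; exact: locint_cst.
Qed.

(** The mean is optimal up to a factor two among the constants that one may
subtract, so oscillations can be estimated with any convenient [c]. *)
Lemma mosc_le f (c : R) : locint f ->
  mosc f <= 2 * avg B (fun y => `|f y - c|).
Proof.
move=> If; have Ic := locint_dev c If.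
apply: (@le_trans _ _ (avg B (fun y => `|f y - c| + `|avg B f - c|))).
  apply: le_avg => //; first exact: locint_dev.
    by apply: locintD => //; exact: locint_cst.
  by move=> y _; rewrite (distrC (avg B f)) ler_distD.
rewrite avgD// ?avg_cst; last exact: locint_cst.
by rewrite mulr_natl mulr2n lerD2l norm_avg_sub.
Qed.

Lemma mosc_le_norm f : locint f -> mosc f <= 2 * avg B (fun y => `|f y|).
Proof.
move=> If; apply: le_trans (mosc_le 0 If) _.
by under eq_fun do rewrite subr0.
Qed.

Lemma moscZ (c : R) f : locint f ->
  mosc (fun y => c * f y) = `|c| * mosc f.
Proof.
move=> If; rewrite /mosc avgZ// -[RHS]avgZ; last exact: locint_dev.
by congr (avg _ _); apply/funext => y; rewrite -mulrBr normrM.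
Qed.

Lemma eq_mosc f g : (forall y, B y -> f y = g y) -> mosc f = mosc g.
Proof.
by move=> fg; rewrite /mosc (eq_avg fg); apply: eq_avg => y By; rewrite fg.
Qed.

Lemma mosc_sum (I : Type) (s : seq I) (F : I -> Rn -> R) :
  (forall i, locint (F i)) ->
  mosc (fun y => \sum_(i <- s) F i y) <= \sum_(i <- s) mosc (F i).
Proof.
move=> IF; have ID i := locint_dev (avg B (F i)) (IF i).
rewrite /mosc avg_sum// -(avg_sum _ ID).
apply: le_avg.
- by apply: locint_dev; exact: locint_sum.
- exact: locint_sum.
- by move=> y _; rewrite -sumrB; exact: ler_norm_sum.
Qed.

End on_a_ball.

Lemma avg_sub_ball x r y s f : 0 < r -> 0 < s -> eball y s `<=` eball x r ->
  locint f -> (forall z, 0 <= f z) ->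
  avg (eball y s) f <= (n.+1%:R * (r / s)) ^+ n * avg (eball x r) f.
Proof.
move=> r0 s0 sub If f0; rewrite !avgE//.
have int_le : \int[mu]_(z in eball y s) f z <= \int[mu]_(z in eball x r) f z.
  have mf := locint_measurable If; apply: fine_le.
  - apply: integrable_fin_num; first exact: measurable_eball.
    exact: locint_ball.
  - apply: integrable_fin_num; first exact: measurable_eball.
    exact: locint_ball.
  - apply: ge0_subset_integral.
    + exact: measurable_eball.
    + exact: measurable_eball.
    + by apply/measurable_EFinP; exact: measurable_funTS.
    + by move=> z _; rewrite lee_fin.
    + exact: sub.
apply: (@le_trans _ _ ((vol y s)^-1 * \int[mu]_(z in eball x r) f z)).
  by rewrite ler_pM2l ?invr_gt0 ?vol_gt0.
rewrite [leRHS]mulrA ler_wpM2r ?Rintegral_ge0//.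
rewrite ler_pdivlMr ?vol_gt0// mulrC ler_pdivrMr ?vol_gt0//.
exact: vol_ratio.
Qed.

End averages.

(** * The space BMO and the bounded operators on it *)

Section bmo_real_form.
Context {R : realType} {n : nat}.
Local Notation Rn := (Rn R n).
Local Notation mu := (leb R n).
Implicit Types (x y z : Rn) (r s C A : R) (f g : Rn -> R).
Variables (V : Rn -> R) (alpha : R).
Hypotheses (n_gt0 : (0 < n)%N) (alpha_ge0 : 0 <= alpha) (alpha_le1 : alpha <= 1).
Local Notation rho := (critical_radius V).

(** [bmo_bound] with the volume [|B| ^ (alpha / n)] replaced by the comparable
[r ^ alpha] and all averages taken in the reals. *)
Definition bmo_le f A :=
  (forall x r, 0 < r -> mosc x r f <= A * r `^ alpha) /\
  (forall x r, 0 < r -> rho x <= r ->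
     avg (eball x r) (fun y => `|f y|) <= A * r `^ alpha).

Lemma bmo_leW f A A' : A <= A' -> bmo_le f A -> bmo_le f A'.
Proof.
move=> AA' [H1 H2]; split=> [x r r0|x r r0 xr].
  by apply: le_trans (H1 _ _ r0) _; rewrite ler_wpM2r// powR_ge0.
by apply: le_trans (H2 _ _ r0 xr) _; rewrite ler_wpM2r// powR_ge0.
Qed.

Let root_pow (a : R) : 0 <= a -> (a ^+ n) `^ (alpha / n%:R) = a `^ alpha.
Proof.
move=> a0; rewrite -powR_mulrn// -powRrM; congr (_ `^ _).
by rewrite mulrCA mulfV ?mulr1// pnatr_eq0 -lt0n.
Qed.

Let expo_ge0 : 0 <= alpha / n%:R. Proof. by rewrite divr_ge0. Qed.

Lemma vol_powR_le x r : 0 < r -> vol x r `^ (alpha / n%:R) <= 2 * r `^ alpha.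
Proof.
move=> r0; apply: (@le_trans _ _ ((2 * r) `^ alpha)).
  rewrite -root_pow; last by rewrite mulr_ge0// ltW.
  apply: (ge0_ler_powR expo_ge0).
  - by rewrite nnegrE ltW// vol_gt0.
  - by rewrite nnegrE exprn_ge0// mulr_ge0// ltW.
  - exact: vol_le.
rewrite powRM// ?(ltW r0)// ler_wpM2r ?powR_ge0//.
by apply: ler1_powR => //; rewrite ler1n.
Qed.

Lemma vol_powR_ge x r : 0 < r ->
  r `^ alpha <= n.+1%:R * vol x r `^ (alpha / n%:R).
Proof.
move=> r0; have c0 : 0 < 2 / n.+1%:R :> R by rewrite divr_gt0.
have c1 : 2 / n.+1%:R <= 1 :> R by rewrite ler_pdivrMr// mul1r ler_nat ltnS.
have h : 2 / n.+1%:R * r `^ alpha <= vol x r `^ (alpha / n%:R).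
  apply: (@le_trans _ _ ((2 * (r / n.+1%:R)) `^ alpha)).
    rewrite (_ : 2 * (r / _) = 2 / n.+1%:R * r); last by ring.
    rewrite powRM ?(ltW r0) ?(ltW c0)// ler_wpM2r ?powR_ge0//.
    by apply: ger1_powR; rewrite ?c0.
  rewrite -root_pow; last by rewrite mulr_ge0// divr_ge0// ltW.
  apply: (ge0_ler_powR expo_ge0).
  - by rewrite nnegrE exprn_ge0// mulr_ge0 ?divr_ge0// ltW.
  - by rewrite nnegrE ltW// vol_gt0.
  - exact: vol_ge.
have := ler_wpM2l (ltW (ltr0Sn R n)) h; apply: le_trans.
rewrite mulrA (mulrC 2) mulrA divff ?pnatr_eq0// mul1r ler_peMl ?powR_ge0//.
by rewrite ler1n.
Qed.

Lemma bmo_boundE f C : locint f -> bmo_bound V alpha f C <->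
  (forall x r, 0 < r -> mosc x r f <= C * vol x r `^ (alpha / n%:R)) /\
  (forall x r, 0 < r -> rho x <= r ->
    avg (eball x r) (fun y => `|f y|) <= C * vol x r `^ (alpha / n%:R)).
Proof.
move=> If; have In := locint_norm If.
split=> -[H1 H2]; split=> [x r r0|x r r0 xr].
- by have := H1 x r r0; rewrite oscE// leb_eballE// poweR_EFin -EFinM lee_fin.
- by have := H2 _ _ r0 xr;
    rewrite eavgE// leb_eballE// poweR_EFin -EFinM lee_fin.
- by rewrite oscE// leb_eballE// poweR_EFin -EFinM lee_fin H1.
- by rewrite eavgE// leb_eballE// poweR_EFin -EFinM lee_fin H2.
Qed.

Lemma bmo_boundW f C C' : locint f -> C <= C' ->
  bmo_bound V alpha f C -> bmo_bound V alpha f C'.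
Proof.
move=> If CC' /(bmo_boundE _ If)[H1 H2]; apply/(bmo_boundE _ If).
split=> [x r r0|x r r0 xr].
  by apply: le_trans (H1 _ _ r0) _; rewrite ler_wpM2r// powR_ge0.
by apply: le_trans (H2 _ _ r0 xr) _; rewrite ler_wpM2r// powR_ge0.
Qed.

Lemma bmo_bound_ge0 f C : locint f -> bmo_bound V alpha f C -> 0 <= C.
Proof.
move=> If /(bmo_boundE _ If)[H1 _].
have := le_trans (mosc_ge0 point ltr01 f) (H1 point 1 ltr01).
by rewrite pmulr_lge0// powR_gt0// vol_gt0.
Qed.

Lemma bmo_bound_le f C : locint f ->
  bmo_bound V alpha f C -> bmo_le f (2 * C).
Proof.
move=> If fC; have C0 := bmo_bound_ge0 If fC.
have /(bmo_boundE _ If)[H1 H2] := fC.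
have w x r : 0 < r -> C * vol x r `^ (alpha / n%:R) <= 2 * C * r `^ alpha.
  by move=> r0; rewrite -mulrA mulrCA ler_wpM2l// vol_powR_le.
split=> [x r r0|x r r0 xr].
  exact: le_trans (H1 _ _ r0) (w _ _ r0).
exact: le_trans (H2 _ _ r0 xr) (w _ _ r0).
Qed.

Lemma le_bmo_bound f A : locint f -> 0 <= A ->
  bmo_le f A -> bmo_bound V alpha f (n.+1%:R * A).
Proof.
move=> If A0 [H1 H2].
have w x r : 0 < r ->
    A * r `^ alpha <= n.+1%:R * A * vol x r `^ (alpha / n%:R).
  by move=> r0; rewrite -mulrA mulrCA ler_wpM2l// vol_powR_ge.
apply/(bmo_boundE _ If); split=> [x r r0|x r r0 xr].
  exact: le_trans (H1 _ _ r0) (w _ _ r0).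
exact: le_trans (H2 _ _ r0 xr) (w _ _ r0).
Qed.

Lemma bmo_norm_le f C : locint f -> bmo_bound V alpha f C ->
  bmo_norm V alpha f <= C.
Proof.
move=> If fC; apply: ge_inf => //; exists 0 => D fD.
exact: bmo_bound_ge0 fD.
Qed.

Lemma bmo_norm_lt f C : bmo V alpha f -> bmo_norm V alpha f < C ->
  bmo_bound V alpha f C.
Proof.
move=> [/locintP If [D [_ fD]]] fC.
have [|C' fC' C'C] := inf_lt (S := [set C | bmo_bound V alpha f C]) _ fC.
  by exists D.
exact: bmo_boundW If (ltW C'C) fC'.
Qed.

(** The norm is an infimum of admissible constants, so an operator is bounded as
soon as it multiplies admissible constants by a fixed factor; this removes both
infima. *)
Lemma bounded_on_bmoP (T : (Rn -> R) -> (Rn -> R)) :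
  bounded_on_bmo V alpha T <->
  exists M, 1 <= M /\ forall f A, locint f -> 0 < A -> bmo_le f A ->
    locint (T f) /\ bmo_le (T f) (M * A).
Proof.
have n1 : 1 <= n.+1%:R :> R by rewrite ler1n.
split=> [[Tbmo [M TM]]|[M [M1 TM]]].
  exists (1 + 2 * n.+1%:R * (`|M| + 1)); split.
    by rewrite lerDl mulr_ge0// ?mulr_ge0// addr_ge0.
  move=> f A If A0 fA; have fC := le_bmo_bound If (ltW A0) fA.
  have C0 : 0 < n.+1%:R * A by rewrite mulr_gt0// (lt_le_trans ltr01).
  have fbmo : bmo V alpha f by split; [exact/locintP|exists (n.+1%:R * A)].
  have Tf := Tbmo _ fbmo; have ITf : locint (T f) by case: Tf => /locintP.
  split=> //; have := bmo_norm_lt (C := (`|M| + 1) * (n.+1%:R * A)) Tf.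
  case.
    apply: le_lt_trans (TM _ fbmo) _.
    apply: (@le_lt_trans _ _ (`|M| * (n.+1%:R * A))).
      apply: (@le_trans _ _ (`|M| * bmo_norm V alpha f)).
        rewrite ler_wpM2r ?ler_norm//; apply: lb_le_inf.
          by exists (n.+1%:R * A).
        by move=> C; exact: bmo_bound_ge0.
      by rewrite ler_wpM2l// bmo_norm_le.
    by rewrite ltr_pM2r// ltrDl.
  move=> H1 H2.
  have := bmo_bound_le ITf (conj H1 H2); apply: bmo_leW.
  rewrite -subr_ge0 (_ : _ - _ = A) ?(ltW A0)//; ring.
have n0 : 0 <= n.+1%:R :> R by exact: le_trans n1.
have M0 : 0 < M by exact: lt_le_trans M1.
have key f C : locint f -> 0 < C -> bmo_bound V alpha f C ->
    locint (T f) /\ bmo_bound V alpha (T f) (n.+1%:R * (M * (2 * C))).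
  move=> If C0 fC; have C20 : 0 < 2 * C by rewrite mulr_gt0.
  have [ITf TfA] := TM _ _ If C20 (bmo_bound_le If fC); split=> //.
  by apply: le_bmo_bound => //; rewrite mulr_ge0 ?ltW.
split=> [f [/locintP If [C [C0 fC]]]|].
  have [ITf TfC] := key _ _ If C0 fC; split; first exact/locintP.
  by exists (n.+1%:R * (M * (2 * C))); split=> //; rewrite !mulr_gt0.
exists (2 * n.+1%:R * M) => f fbmo; have [/locintP If [D [D0 fD]]] := fbmo.
have nf0 : 0 <= bmo_norm V alpha f.
  by apply: lb_le_inf; [exists D|move=> C; exact: bmo_bound_ge0].
apply/ler_addgt0Pr => e e0.
pose d := e / (2 * n.+1%:R * M).
have d0 : 0 < d by rewrite divr_gt0// !mulr_gt0.
have fd : bmo_bound V alpha f (bmo_norm V alpha f + d).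
  by apply: bmo_norm_lt => //; rewrite ltrDl.
have [ITf TfC] := key _ _ If (ltr_wpDl nf0 d0) fd.
apply: le_trans (bmo_norm_le ITf TfC) _.
rewrite (_ : e = 2 * n.+1%:R * M * d).
  by rewrite le_eqVlt; apply/orP; left; apply/eqP; ring.
by rewrite /d mulrC divfK// gt_eqF// !mulr_gt0.
Qed.

(** The gain [G] measures by how much the averages of a function of bounded mean
oscillation may exceed its oscillation below the critical radius; the
oscillation of [psi] has to be smaller by that factor. *)
Lemma multiplier_bounded (psi : Rn -> R) (G : Rn -> R -> R) (K C L : R) :
  measurable_fun [set: Rn] psi ->
  {ae mu, forall x, `|psi x| <= L} -> 0 <= L -> 0 <= K -> 0 <= C ->
  (forall x s, 0 < s -> s < rho x / 2 -> G x s * mosc x s psi <= C) ->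
  (forall f A x s, locint f -> 0 < A -> bmo_le f A ->
     0 < s -> s < rho x / 2 -> `|avg (eball x s) f| <= K * A * s `^ alpha * G x s) ->
  bounded_on_bmo V alpha (multiplier psi).
Proof.
move=> mpsi psiL L0 K0 C0 psiG avgG; apply/bounded_on_bmoP.
pose D : R := (n.+1%:R * 2) ^+ n.
have D0 : 0 <= D by rewrite exprn_ge0// mulr_ge0.
have KC0 : 0 <= K * C by rewrite mulr_ge0.
have DL0 : 0 <= D * L by rewrite mulr_ge0.
exists (1 + 4 * (L + K * C + D * L)); split.
  by rewrite lerDl mulr_ge0// !addr_ge0.
move=> f A If A0 fA; have Ipsi := locint_bounded mpsi psiL.
have IT : locint (multiplier psi f) by exact: locint_mul psiL.
split=> //; have [fosc favg] := fA.
have InT := locint_norm IT; have Inf := locint_norm If.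
have absT x r : 0 < r -> rho x <= r ->
    avg (eball x r) (fun y => `|multiplier psi f y|) <= L * A * r `^ alpha.
  move=> r0 xr; rewrite -mulrA; apply: le_trans (ler_wpM2l L0 (favg _ _ r0 xr)).
  rewrite -avgZ//; apply: le_avg_ae => //; first exact: locintZ.
  apply: filterS psiL => y yL; rewrite /multiplier normrM mulrC.
  by rewrite ler_wpM2r.
have pow0 r : 0 <= A * r `^ alpha by rewrite mulr_ge0 ?powR_ge0// ltW.
split=> [x r r0|x r r0 xr]; last first.
  apply: le_trans (absT _ _ r0 xr) _; rewrite -!mulrA ler_wpM2r//.
  by lra.
have [xr|rx] := leP (rho x) r.
  apply: le_trans (mosc_le_norm x r0 IT) _.
  apply: le_trans (ler_wpM2l _ (absT _ _ r0 xr)) _ => //.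
  rewrite (_ : 2 * _ = 2 * L * (A * r `^ alpha)); last by ring.
  rewrite -[leRHS]mulrA ler_wpM2r//; lra.
(* one doubling reaches the critical radius *)
have [xr|{}rx] := leP (rho x / 2) r.
  apply: le_trans (mosc_le_norm x r0 IT) _.
  have r20 : 0 < 2 * r by rewrite mulr_gt0.
  have sub : eball x r `<=` eball x (2 * r).
    by apply: sub_eball; rewrite edistxx; lra.
  apply: (@le_trans _ _ (2 * (D * (L * A * (2 * r) `^ alpha)))).
    rewrite ler_wpM2l//.
    apply: le_trans (avg_sub_ball r20 r0 sub InT _) _ => //.
    rewrite (_ : 2 * r / r = 2); last by rewrite mulfK// gt_eqF.
    by rewrite ler_wpM2l// absT//; lra.
  apply: (@le_trans _ _ (4 * (D * L) * (A * r `^ alpha))).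
    rewrite powRM ?(ltW r0)// (_ : 2 * _ = (D * L * (A * r `^ alpha)) * (2 * 2 `^ alpha)).
      have p2 : 2 * 2 `^ alpha <= 4 :> R.
        have : 2 `^ alpha <= 2 :> R by apply: ler1_powR => //; rewrite ler1n.
        lra.
      by have := ler_wpM2l (mulr_ge0 DL0 (pow0 r)) p2; lra.
    by ring.
  rewrite -[leRHS]mulrA ler_wpM2r//; lra.
set fB := avg (eball x r) f; set pB := avg (eball x r) psi.
have Ifd : locint (fun y => `|f y - fB|) by exact: locint_dev.
have Ipd : locint (fun y => `|psi y - pB|) by exact: locint_dev.
(* f psi - f_B psi_B = (f - f_B) psi + f_B (psi - psi_B) *)
apply: le_trans (mosc_le x r0 (fB * pB) IT) _.
apply: (@le_trans _ _ (2 * (L * mosc x r f + `|fB| * mosc x r psi))).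
  rewrite ler_wpM2l// /mosc -/fB -/pB -(avgZ x r0 L Ifd) -(avgZ x r0 `|fB| Ipd).
  rewrite -avgD; [|exact: r0|exact: locintZ|exact: locintZ].
  apply: le_avg_ae; first exact: r0.
  - exact: locint_dev.
  - by apply: locintD; exact: locintZ.
  - by move=> y; exact: normr_ge0.
  apply: filterS psiL => y yL.
  rewrite /multiplier (_ : f y * psi y - fB * pB
    = (f y - fB) * psi y + fB * (psi y - pB)); last by ring.
  apply: le_trans (ler_normD _ _) _; rewrite !normrM lerD2r mulrC.
  by rewrite ler_wpM2r.
have h1 : L * mosc x r f <= L * (A * r `^ alpha) by rewrite ler_wpM2l// fosc.
have h2 : `|fB| * mosc x r psi <= K * C * (A * r `^ alpha).
  apply: le_trans (ler_wpM2r (mosc_ge0 x r0 _) (avgG _ _ _ _ If A0 fA r0 rx)) _.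
  rewrite [leLHS](_ : _ = K * (A * r `^ alpha) * (G x r * mosc x r psi)); last by ring.
  apply: le_trans (ler_wpM2l _ (psiG _ _ r0 rx)) _; first by rewrite mulr_ge0.
  by rewrite mulrAC.
rewrite -[leRHS]mulrA; move: h1 h2 (pow0 r).
move: (A * _) (L * mosc x r f) (`|fB| * _) => p a b h1 h2 p0.
apply: (@le_trans _ _ (2 * (L + K * C) * p)); first by lra.
by rewrite ler_wpM2r//; lra.
Qed.

End bmo_real_form.

(** * Growth of averages below the critical radius *)

Section telescoping.
Context {R : realType} {n : nat}.
Local Notation Rn := (Rn R n).
Local Notation mu := (leb R n).
Implicit Types (x y z : Rn) (r s A : R) (f g : Rn -> R).
Variable (V : Rn -> R).
Local Notation rho := (critical_radius V).

Lemma dyadic_scale (u : R) : 1 <= u -> exists k, 2 ^+ k <= u < 2 ^+ k.+1.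
Proof.
move=> u1.
have ex : exists k, u < 2 ^+ k.
  exists (Num.truncn u).+1; rewrite -natrX.
  apply: lt_le_trans (truncnS_gt u) _; rewrite ler_nat.
  exact/ltnW/ltn_expl.
have [[|k] uk kmin] := ex_minnP ex.
  by move: uk; rewrite expr0 ltNge u1.
exists k; rewrite uk andbT leNgt; apply/negP => /kmin.
by rewrite ltnn.
Qed.

Let D : R := (n.+1%:R * 2) ^+ n.

Let D_ge0 : 0 <= D. Proof. by rewrite exprn_ge0// mulr_ge0. Qed.

Lemma avg_double (alpha : R) f A x r : locint f -> bmo_le V alpha f A -> 0 < r ->
  `|avg (eball x r) f| <=
  `|avg (eball x (2 * r)) f| + D * (A * (2 * r) `^ alpha).
Proof.
move=> If [fosc _] r0; have r20 : 0 < 2 * r by rewrite mulr_gt0.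
set c := avg (eball x (2 * r)) f.
rewrite -lerBlDl; apply: le_trans (ler_norm _) _.
apply: le_trans (ler_dist_dist _ _) _.
apply: le_trans (norm_avg_sub x r0 c If) _.
have sub : eball x r `<=` eball x (2 * r).
  by apply: sub_eball; rewrite edistxx; lra.
apply: le_trans (avg_sub_ball r20 r0 sub (locint_dev c If) _) _ => //.
rewrite (_ : 2 * r / r = 2); last by rewrite mulfK// gt_eqF.
by rewrite ler_wpM2l// fosc.
Qed.

(** Each of the [k] doublings that lead to the critical radius costs one
oscillation, and those are all of the same size when [alpha = 0]. *)
Lemma avg_log f A x r k : locint f -> bmo_le V 0 f A -> 0 < r ->
  rho x <= 2 ^+ k * r -> `|avg (eball x r) f| <= A * (1 + D * k%:R).
Proof.
move=> If fA; elim: k r => [|k IHk] r r0.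
  rewrite expr0 mul1r => xr; rewrite mulr0 addr0 mulr1.
  apply: le_trans (norm_avg x r0 If) _.
  by case: fA => _ /(_ x r r0 xr); rewrite powRr0 mulr1.
move=> xr; apply: le_trans (avg_double x If fA r0) _.
rewrite powRr0 mulr1.
have r20 : 0 < 2 * r by rewrite mulr_gt0.
have := IHk _ r20; rewrite mulrA -exprSr => /(_ xr) h.
rewrite -natr1; lra.
Qed.

(** For a positive exponent the increments are geometric; subtracting the
multiple [L] of the current scale makes the bound stable under doubling. *)
Lemma avg_power (alpha L : R) f A x r k :
  L * (2 `^ alpha - 1) = D * 2 `^ alpha ->
  locint f -> bmo_le V alpha f A ->
  0 < r -> rho x <= 2 ^+ k * r ->
  `|avg (eball x r) f| <=
  A * ((1 + L) * (2 ^+ k * r) `^ alpha - L * r `^ alpha).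
Proof.
move=> LP If fA; elim: k r => [|k IHk] r r0.
  rewrite expr0 mul1r => xr.
  rewrite (_ : _ - _ = r `^ alpha); last by ring.
  apply: le_trans (norm_avg x r0 If) _.
  by case: fA => _ /(_ x r r0 xr).
move=> xr; apply: le_trans (avg_double x If fA r0) _.
have r20 : 0 < 2 * r by rewrite mulr_gt0.
have := IHk _ r20; rewrite mulrA -exprSr => /(_ xr) h.
apply: le_trans (lerD h (lexx _)) _.
rewrite (powRM _ (ler0n _ 2) (ltW r0)); move: LP; set P := 2 `^ alpha; set W := r `^ alpha => LP.
rewrite (_ : D * (A * (P * W)) = A * (W * (D * P))); last by ring.
rewrite -LP.
by rewrite le_eqVlt; apply/orP; left; apply/eqP; ring.
Qed.

(** As [s < rho x / 2], the additive constant and the rounding of the number of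
doublings are absorbed in the logarithm. *)
Lemma log_gain : exists K, 0 <= K /\
  forall f A x s, locint f -> 0 < A -> bmo_le V 0 f A ->
    0 < s -> s < rho x / 2 ->
    `|avg (eball x s) f| <= K * A * s `^ 0 * ln (rho x / s).
Proof.
have l2 : 0 < ln 2 :> R by rewrite ln_gt0// ltr1n.
exists ((1 + 2 * D) / ln 2); split.
  by rewrite divr_ge0 ?(ltW l2)// addr_ge0// mulr_ge0.
move=> f A x s If A0 fA s0 sx.
have u2 : 2 < rho x / s by rewrite ltr_pdivlMr//; lra.
have [k /andP[k1 k2]] := dyadic_scale (ltW (lt_trans (ltr1n R 2) u2)).
have xk : rho x <= 2 ^+ k.+1 * s by rewrite -ler_pdivrMr// ltW.
apply: le_trans (avg_log If fA s0 xk) _.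
rewrite powRr0 mulr1 (_ : _ * ln _ = A * ((1 + 2 * D) * (ln (rho x / s) / ln 2))).
  rewrite ler_pM2l//.
  set t := ln (rho x / s) / ln 2.
  have t1 : 1 <= t.
    by rewrite ler_pdivlMr// mul1r ler_ln ?posrE ?(ltW u2)// (lt_trans _ u2).
  have tk : k%:R <= t.
    rewrite ler_pdivlMr// mulr_natl -lnXn// ler_ln ?posrE ?exprn_gt0//.
    by rewrite (lt_trans _ u2).
  have tk1 : k.+1%:R <= 2 * t by rewrite -natr1; lra.
  have := ler_wpM2l D_ge0 tk1; lra.
by rewrite mulrCA mulrA; ring.
Qed.

Lemma power_gain (alpha : R) : 0 < alpha -> alpha <= 1 -> exists K, 0 <= K /\
  forall f A x s, locint f -> 0 < A -> bmo_le V alpha f A ->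
    0 < s -> s < rho x / 2 ->
    `|avg (eball x s) f| <= K * A * s `^ alpha * (rho x / s) `^ alpha.
Proof.
move=> alpha0 alpha1; set L := D * 2 `^ alpha / (2 `^ alpha - 1).
have L0 : 0 <= L.
  rewrite divr_ge0 ?mulr_ge0 ?powR_ge0// subr_ge0.
  by rewrite -[X in X <= _](powRr0 2) ler_powR ?ler1n// ltW.
have LP : L * (2 `^ alpha - 1) = D * 2 `^ alpha.
  rewrite /L divfK// subr_eq0 gt_eqF//.
  have := gt0_ltr_powR alpha0 (x := 1) (y := 2); rewrite powR1; apply.
  - by rewrite nnegrE.
  - by rewrite nnegrE.
  - by rewrite ltr1n.
clearbody L.
exists (2 * (1 + L)); split; first by rewrite mulr_ge0// addr_ge0.
move=> f A x s If A0 fA s0 sx.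
have x0 : 0 < rho x by lra.
have u2 : 2 < rho x / s by rewrite ltr_pdivlMr//; lra.
have [k /andP[k1 k2]] := dyadic_scale (ltW (lt_trans (ltr1n R 2) u2)).
have xk : rho x <= 2 ^+ k.+1 * s by rewrite -ler_pdivrMr// ltW.
apply: le_trans (avg_power LP If fA s0 xk) _.
rewrite -!mulrA -powRM ?(ltW s0)//; last by rewrite divr_ge0 ?(ltW x0) ?(ltW s0).
rewrite (mulrC s) divfK ?gt_eqF//.
apply: (@le_trans _ _ (A * ((1 + L) * (2 * rho x `^ alpha)))); last first.
  by rewrite le_eqVlt; apply/orP; left; apply/eqP; ring.
rewrite ler_wpM2l ?(ltW A0)//.
apply: (@le_trans _ _ ((1 + L) * (2 ^+ k.+1 * s) `^ alpha)).
  by rewrite gerBl mulr_ge0 ?powR_ge0.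
rewrite ler_wpM2l ?addr_ge0//.
apply: (@le_trans _ _ ((2 * rho x) `^ alpha)).
  apply: (ge0_ler_powR (ltW alpha0)).
  - by rewrite nnegrE mulr_ge0 ?exprn_ge0// ltW.
  - by rewrite nnegrE mulr_ge0// ltW.
  - by rewrite exprS -mulrA ler_pM2l// -ler_pdivlMr.
rewrite powRM ?(ltW x0)// ler_wpM2r ?powR_ge0//.
by apply: ler1_powR => //; rewrite ler1n.
Qed.

End telescoping.

(** * Test functions *)

Section plateaus.
Context {R : realType} {n : nat}.
Local Notation Rn := (Rn R n).
Local Notation mu := (leb R n).
Implicit Types (x y z o : Rn) (r s t c : R) (f g : Rn -> R).

Definition plateau o t (y : Rn) : R := Num.max 0 (Num.min 1 (2 - edist o y / t)).

Lemma plateau_ge0 o t y : 0 <= plateau o t y.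
Proof. by rewrite /plateau le_max lexx. Qed.

Lemma plateau_le1 o t y : plateau o t y <= 1.
Proof. by rewrite /plateau ge_max ler01 ge_min lexx. Qed.

Lemma plateau_eq1 o t y : 0 < t -> edist o y <= t -> plateau o t y = 1.
Proof.
move=> t0 yt; have : edist o y / t <= 1 by rewrite ler_pdivrMr// mul1r.
move=> h; rewrite /plateau min_l; last by lra.
by rewrite max_r.
Qed.

Lemma plateau_eq0 o t y : 0 < t -> 2 * t <= edist o y -> plateau o t y = 0.
Proof.
move=> t0 yt; have : 2 <= edist o y / t by rewrite ler_pdivlMr.
by move=> h; rewrite /plateau max_l// ge_min; apply/orP; right; lra.
Qed.

Lemma plateau_lip o t y z : 0 < t -> `|plateau o t y - plateau o t z| <= edist y z / t.
Proof.
move=> t0; rewrite /plateau.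
have : `|edist o y / t - edist o z / t| <= edist y z / t.
  rewrite -mulrBl normrM [X in _ * X]gtr0_norm ?invr_gt0//.
  rewrite ler_pM2r ?invr_gt0// ler_norml.
  have := edist_triangle y o z; have := edist_triangle z o y.
  rewrite (edistC z y) => h1 h2; apply/andP; split; lra.
set p := edist o y / t; set q := edist o z / t; set d := edist y z / t.
rewrite !ler_norml => /andP[h1 h2].
rewrite /Num.max /Num.min.
do ! case: ifPn; rewrite -?leNgt; move=> *; apply/andP; split; lra.
Qed.

Lemma locint_plateau o t : locint (plateau o t).
Proof.
apply: (@locint_bounded _ _ _ 1).
  apply: measurable_maxr; first exact: measurable_cst.
  apply: measurable_minr; first exact: measurable_cst.
  apply: measurable_funB; first exact: measurable_cst.
  apply: measurable_funM; last exact: measurable_cst.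
  exact: measurable_edist.
by apply: aeW => y; rewrite ger0_norm ?plateau_ge0// plateau_le1.
Qed.

Lemma avg_plateau_le1 o t x r : 0 < r -> avg (eball x r) (plateau o t) <= 1.
Proof.
move=> r0; rewrite -[leRHS](avg_cst x r0 1).
apply: le_avg; [exact: r0|exact: locint_plateau|exact: locint_cst|].
by move=> y _; exact: plateau_le1.
Qed.

(** A ball much larger than the plateau sees little of it.  The exponent [n] of
the volume ratio is lowered to one, which is all that summability needs. *)
Lemma avg_plateau o t x r : (0 < n)%N -> 0 < t -> 0 < r ->
  avg (eball x r) (plateau o t) <= n.+1%:R * (2 * t / r).
Proof.
move=> n0 t0 r0; set q := _ * _.
have q0 : 0 <= q by rewrite !mulr_ge0 ?invr_ge0// ltW.
have [q1|q1] := leP 1 q; first exact: le_trans (avg_plateau_le1 _ _ _ r0) q1.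
have t20 : 0 < 2 * t by rewrite mulr_gt0.
apply: (@le_trans _ _ (q ^+ n)); last first.
  rewrite -(prednK n0) exprS -[leRHS]mulr1 ler_wpM2l//.
  by rewrite exprn_ile1// ltW.
rewrite avgE//; last exact: locint_plateau.
rewrite mulrC ler_pdivrMr ?vol_gt0//.
apply: le_trans (vol_ratio o x t20 r0).
rewrite -lee_fin -leb_eballE// /Rintegral fineK; last first.
  apply: integrable_fin_num; first exact: measurable_eball.
  exact: locint_ball (locint_plateau o t) x r.
have mB := @measurable_eball R n o (2 * t).
have mBr := @measurable_eball R n x r.
apply: (@le_trans _ _ (\int[mu]_(y in eball x r) (\1_(eball o (2 * t)) y)%:E)%E).
  apply: ge0_le_integral; first exact: mBr.
  - by move=> y _; rewrite lee_fin plateau_ge0.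
  - apply/measurable_EFinP; apply: measurable_funTS.
    exact: locint_measurable (locint_plateau o t).
  - apply/measurable_EFinP; apply: measurable_funTS.
    exact: measurable_indic.
  - move=> y _; rewrite lee_fin indicE.
    have [yB|yB] := boolP (y \in _); first exact: plateau_le1.
    rewrite plateau_eq0// leNgt; apply/negP => h.
    by move/negP : yB; apply; rewrite inE.
rewrite integral_indic; [|exact: mBr|exact: mB].
apply: le_measure; rewrite ?inE; [exact: measurableI|exact: mB|].
exact: subIsetl.
Qed.

Lemma mosc_plateau_small o t x r : 0 < t -> 0 < r ->
  mosc x r (plateau o t) <= 2 * (r / t).
Proof.
move=> t0 r0; apply: le_trans (mosc_le x r0 (plateau o t x) (locint_plateau o t)) _.
rewrite ler_wpM2l// -[leRHS](avg_cst x r0).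
apply: le_avg; [exact: r0|exact: locint_dev (locint_plateau o t)|exact: locint_cst|].
move=> y xy; apply: le_trans (plateau_lip _ _ _ t0) _.
by rewrite ler_pM2r ?invr_gt0// edistC ltW.
Qed.

Lemma mosc_plateau_large o t x r : (0 < n)%N -> 0 < t -> 0 < r ->
  mosc x r (plateau o t) <= 4 * n.+1%:R * (t / r).
Proof.
move=> n0 t0 r0; apply: le_trans (mosc_le_norm x r0 (locint_plateau o t)) _.
rewrite (@eq_avg _ _ _ _ _ (plateau o t)); last first.
  by move=> y _; rewrite ger0_norm// plateau_ge0.
have := avg_plateau o x n0 t0 r0; move: (avg _ _) => a ha.
rewrite (_ : _ * (t / r) = 2 * (n.+1%:R * (2 * t / r))); last by ring.
by rewrite ler_wpM2l.
Qed.

Lemma mosc_plateau o t x r : (0 < n)%N -> 0 < t -> 0 < r ->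
  mosc x r (plateau o t) <= 4 * n.+1%:R * Num.min (t / r) (r / t).
Proof.
move=> n0 t0 r0; have [h|h] := leP (t / r) (r / t); first exact: mosc_plateau_large.
apply: le_trans (mosc_plateau_small o x t0 r0) _.
rewrite ler_wpM2r ?divr_ge0 ?(ltW t0) ?(ltW r0)//.
by rewrite -[leLHS]mulr1 ler_pM// ?ler_nat// ler1n.
Qed.

(** What a ball sees of the plateaus of all dyadic widths: the terms decay
geometrically on both sides of the scale [u = 2 ^ j], whatever their number. *)
Lemma sum_min_dyadic (J : nat) (u : R) : 0 < u ->
  \sum_(j < J) Num.min (u / 2 ^+ j) (2 ^+ j / u) <= 4.
Proof.
move=> u0; suff [] : (u <= 1 ->
    \sum_(j < J) Num.min (u / 2 ^+ j) (2 ^+ j / u) <= 2 * u) /\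
  (1 < u -> \sum_(j < J) Num.min (u / 2 ^+ j) (2 ^+ j / u) <= 4 - 2 / u).
  move=> h1 h2; have [u1|u1] := leP u 1.
    apply: le_trans (h1 u1) _; lra.
  by apply: le_trans (h2 u1) _; rewrite gerBl divr_ge0// ltW.
elim: J u u0 => [|J IHJ] u u0.
  rewrite big_ord0; split=> [_|u1]; first by rewrite mulr_ge0// ltW.
  by rewrite subr_ge0 ler_pdivrMr//; lra.
rewrite big_ord_recl expr0 divr1 mul1r.
rewrite (eq_bigr (fun j : 'I_J =>
    Num.min ((u / 2) / 2 ^+ j) (2 ^+ j / (u / 2)))); last first.
  move=> j _; rewrite lift0 exprS; congr (Num.min _ _).
    by rewrite invfM mulrA.
  by rewrite invf_div [RHS]mulrA (mulrC 2).
have u20 : 0 < u / 2 by rewrite divr_gt0.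
have [IH1 IH2] := IHJ _ u20.
split=> u1.
  have h : u / 2 <= 1 by lra.
  have -> : Num.min u u^-1 = u.
    by rewrite min_l// -[leRHS]mul1r ler_pdivlMr//; nra.
  have := IH1 h; set S := \sum_(_ < _) _; lra.
have -> : Num.min u u^-1 = u^-1.
  by rewrite min_r// -[leLHS]mul1r ler_pdivrMr//; nra.
have uV : u * u^-1 = 1 by rewrite mulfV// gt_eqF.
have [u2|u2] := leP u 2.
  have h : u / 2 <= 1 by lra.
  have := IH1 h; set S := \sum_(_ < _) _ => hS.
  suff : u^-1 + u <= 4 - 2 / u by lra.
  rewrite -subr_ge0 -(pmulr_rge0 _ u0).
  rewrite (_ : _ * _ = 4 * u - u ^+ 2 - 3 * (u * u^-1)); last by ring.
  rewrite uV; nra.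
have h : 1 < u / 2 by lra.
have := IH2 h; rewrite invf_div; set S := \sum_(_ < _) _ => hS.
have : 0 < u^-1 by rewrite invr_gt0.
lra.
Qed.

Lemma sum_dyadic_le (J : nat) : \sum_(j < J) (2 ^+ j)^-1 <= 2 :> R.
Proof.
suff -> : \sum_(j < J) (2 ^+ j)^-1 = 2 - 2 / 2 ^+ J :> R.
  by rewrite gerBl divr_ge0// exprn_ge0.
elim: J => [|J IHJ]; first by rewrite big_ord0 expr0 divr1 subrr.
rewrite big_ord_recr/= IHJ exprS invfM mulrA divff// mul1r.
by move: (2 ^+ J)^-1 => p; ring.
Qed.

Variables (V : Rn -> R).
Hypothesis n_gt0 : (0 < n)%N.
Local Notation rho := (critical_radius V).

(** What the second condition in the definition of BMO requires of the critical
radii around [o], for a test function supported in the ball of radius [2 * t]. *)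
Definition clear_of c o t := forall y r, 0 < r -> rho y <= r ->
  c * t <= r \/ forall z, eball y r z -> 2 * t <= edist o z.

Lemma bmo_le_plateau (alpha : R) c o t : 0 <= alpha -> alpha <= 1 ->
  0 < c -> c <= 1 -> 0 < t -> clear_of c o t ->
  bmo_le V alpha (fun y => t `^ alpha * plateau o t y) (4 * n.+1%:R / c).
Proof.
move=> a0 a1 c0 c1 t0 tc; have Ib := locint_plateau o t.
have tp : 0 <= t `^ alpha by exact: powR_ge0.
have cV : 1 <= c^-1 by rewrite invf_ge1.
have n4 : 1 <= 4 * n.+1%:R :> R by rewrite -natrM ler1n.
split=> [x r r0|x r r0 xr].
  have rp : 0 <= r `^ alpha by exact: powR_ge0.
  rewrite moscZ// ger0_norm//.
  apply: le_trans (ler_wpM2l tp (mosc_plateau o x n_gt0 t0 r0)) _.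
  rewrite mulrCA -[leRHS]mulrA -[leRHS]mulrA -[leLHS]mulrA.
  rewrite ler_wpM2l// ler_wpM2l//.
  apply: (@le_trans _ _ (r `^ alpha)); last by rewrite ler_peMl.
  have [rt|tr] := leP r t.
    apply: (@le_trans _ _ (t `^ alpha * (r / t))).
      by rewrite ler_wpM2l// ge_min lexx orbT.
    apply: (@le_trans _ _ (t `^ alpha * (r / t) `^ alpha)).
      rewrite ler_wpM2l//; apply: ger1_powR => //.
      by rewrite divr_gt0//= ler_pdivrMr// mul1r.
    rewrite -powRM ?(ltW t0) ?divr_ge0 ?(ltW r0) ?(ltW t0)//.
    by rewrite mulrC divfK// gt_eqF.
  apply: (@le_trans _ _ (t `^ alpha * (t / r))).
    by rewrite ler_wpM2l// ge_min lexx.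
  apply: (@le_trans _ _ (t `^ alpha)).
    rewrite ler_piMr// ler_pdivrMr// mul1r; exact: ltW.
  apply: (ge0_ler_powR a0); rewrite ?nnegrE; exact: ltW.
have [ctr|away] := tc x r r0 xr; last first.
  rewrite (@eq_avg _ _ _ _ _ (fun=> 0)) ?avg_cst//.
    by rewrite mulr_ge0 ?powR_ge0// mulr_ge0 ?invr_ge0 ?(ltW c0)// (le_trans _ n4).
  by move=> z xz; rewrite plateau_eq0 ?away// mulr0 normr0.
apply: (@le_trans _ _ (t `^ alpha)).
  rewrite (@eq_avg _ _ _ _ _ (fun y => t `^ alpha * plateau o t y)); last first.
    by move=> y _; rewrite ger0_norm// mulr_ge0// plateau_ge0.
  by rewrite avgZ// ler_piMr// avg_plateau_le1.
apply: (@le_trans _ _ (c^-1 * r `^ alpha)); last first.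
  rewrite ler_wpM2r ?powR_ge0// ler_peMl// ?invr_ge0; exact: ltW.
apply: (@le_trans _ _ ((c^-1 * r) `^ alpha)).
  apply: (ge0_ler_powR a0).
  - by rewrite nnegrE ltW.
  - by rewrite nnegrE mulr_ge0 ?invr_ge0 ?(ltW c0) ?(ltW r0).
  - by rewrite mulrC ler_pdivlMr// mulrC.
rewrite powRM ?invr_ge0 ?(ltW c0) ?(ltW r0)// ler_wpM2r ?powR_ge0//.
exact: ler1_powR.
Qed.

(** Up to constants this is the truncated logarithm of [a / |y - o|]; with
plateaus its oscillation reduces to a geometric sum. *)
Definition staircase o (a : R) (J : nat) (y : Rn) : R :=
  \sum_(j < J) plateau o (a / 2 ^+ j) y.

Lemma locint_staircase o a J : locint (staircase o a J).
Proof. by apply: locint_sum => j; exact: locint_plateau. Qed.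

Lemma bmo_le_staircase c o a J : 0 < c -> c <= 1 -> 0 < a -> clear_of c o a ->
  bmo_le V 0 (staircase o a J) (16 * n.+1%:R / c).
Proof.
move=> c0 c1 a0 ac.
have cV : 1 <= c^-1 by rewrite invf_ge1.
have n1 : 0 <= n.+1%:R :> R by [].
have t0 j : 0 < a / 2 ^+ j by rewrite divr_gt0// exprn_gt0.
split=> [x r r0|x r r0 xr]; rewrite powRr0 mulr1.
  apply: le_trans (mosc_sum x r0 _ (fun j => locint_plateau o (a / 2 ^+ nat_of_ord j))) _.
  apply: (@le_trans _ _ (\sum_(j < J) 4 * n.+1%:R *
      Num.min (a / r / 2 ^+ j) (2 ^+ j / (a / r)))).
    apply: ler_sum => j _; apply: le_trans (mosc_plateau o x n_gt0 (t0 j) r0) _.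
    rewrite le_eqVlt; apply/orP; left; apply/eqP; congr (_ * Num.min _ _).
      by rewrite mulrAC.
    by rewrite !invf_div [RHS]mulrA mulrA mulrAC mulrC mulrA mulrAC.
  rewrite -mulr_sumr.
  apply: (@le_trans _ _ (4 * n.+1%:R * 4)).
    by rewrite ler_wpM2l ?mulr_ge0// sum_min_dyadic// divr_gt0.
  rewrite (_ : _ * 4 = 16 * n.+1%:R); last by ring.
  by rewrite ler_peMr// mulr_ge0.
have [car|away] := ac x r r0 xr; last first.
  rewrite (@eq_avg _ _ _ _ _ (fun=> 0)) ?avg_cst//.
    by rewrite !mulr_ge0 ?invr_ge0 ?(ltW c0).
  move=> z xz; rewrite /staircase big1 ?normr0// => j _.
  rewrite plateau_eq0//; apply: le_trans (away _ xz).
  rewrite ler_pM2l// ler_pdivrMr ?exprn_gt0// ler_peMr ?(ltW a0)//.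
  by rewrite exprn_ege1// ler1n.
rewrite (@eq_avg _ _ _ _ _ (staircase o a J)); last first.
  by move=> y _; rewrite ger0_norm// sumr_ge0// => j _; exact: plateau_ge0.
rewrite avg_sum//; last by move=> j; exact: locint_plateau.
apply: (@le_trans _ _ (\sum_(j < J) n.+1%:R * (2 * a / r) * (2 ^+ j)^-1)).
  apply: ler_sum => j _; apply: le_trans (avg_plateau o x n_gt0 (t0 j) r0) _.
  by rewrite le_eqVlt; apply/orP; left; apply/eqP; ring.
rewrite -mulr_sumr.
apply: (@le_trans _ _ (n.+1%:R * (2 * a / r) * 2)).
  rewrite ler_wpM2l ?sum_dyadic_le// !mulr_ge0 ?invr_ge0 ?(ltW a0)//.
  exact: ltW.
have arc : a / r <= c^-1.
  by rewrite ler_pdivrMr// ler_pdivlMl.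
rewrite (_ : _ * 2 = 4 * n.+1%:R * (a / r)); last by ring.
apply: (@le_trans _ _ (4 * n.+1%:R / c)).
  by rewrite ler_wpM2l// mulr_ge0.
by rewrite ler_wpM2r ?invr_ge0 ?(ltW c0)// ler_wpM2r// ler_nat.
Qed.

Lemma staircase_eq o a J y : 0 < a -> edist o y <= a / 2 ^+ J.-1 ->
  staircase o a J y = J%:R.
Proof.
move=> a0 yJ; rewrite /staircase (eq_bigr (fun=> 1)).
  by rewrite sumr_const card_ord.
move=> j _; rewrite plateau_eq1 ?divr_gt0 ?exprn_gt0//.
apply: le_trans yJ _; rewrite ler_pM2l// lef_pV2 ?posrE ?exprn_gt0//.
by rewrite ler_weXn2l ?ler1n// -ltnS (ltn_predK (ltn_ord j)).
Qed.

End plateaus.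

(** * Necessary conditions on a bounded multiplier *)

Section necessity.
Context {R : realType} {n : nat}.
Local Notation Rn := (Rn R n).
Local Notation mu := (leb R n).
Implicit Types (x y z o : Rn) (r s t c : R) (f g : Rn -> R).
Variables (V psi : Rn -> R).
Hypothesis n_gt0 : (0 < n)%N.
Hypothesis mpsi : measurable_fun [set: Rn] psi.
Local Notation rho := (critical_radius V).

Lemma iter_multiplierE (m : nat) f y :
  iter m (multiplier psi) f y = f y * psi y ^+ m.
Proof.
elim: m => [|m IHm]; first by rewrite expr0 mulr1.
by rewrite iterS /multiplier -/(multiplier psi) IHm exprSr mulrA.
Qed.

Let large (L : R) o t := eball o t `&` [set y | L < `|psi y|].

Let measurable_large (L : R) o t : measurable (large L o t).
Proof.
apply: measurableI; first exact: measurable_eball.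
rewrite (_ : [set y | _] = [set: Rn] `&` (fun y => `|psi y|) @^-1` `]L, +oo[).
  have mn := measurableT_comp (@normr_measurable R setT) mpsi.
  by apply: mn; [exact: measurableT|exact: measurable_itv].
by apply/seteqP; split=> y /=; rewrite in_itv/= andbT => // -[].
Qed.

(** Chebyshev's inequality for the [m]-th iterate: a norm growing like [M ^ m]
leaves little room for values of [|psi|] above [M + 1]. *)
Lemma leb_large (alpha M A : R) f o t (m : nat) : 0 < t -> 0 <= M ->
  locint (iter m (multiplier psi) f) ->
  bmo_le V alpha (iter m (multiplier psi) f) (M ^+ m * A) ->
  rho o <= t -> (forall y, eball o t y -> f y = t `^ alpha) ->
  (mu (large (M + 1) o t) <= ((M / (M + 1)) ^+ m * (A * vol o t))%:E)%E.
Proof.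
move=> t0 M0 Im [_ Hm] ot ft; set F := iter m _ f in Im Hm.
have M1 : 0 < M + 1 by rewrite ltr_wpDl.
have tp : 0 < t `^ alpha by exact: powR_gt0.
have Inm := locint_norm Im.
have mB := @measurable_eball R n o t.
have mE := measurable_large (M + 1) o t.
set p := t `^ alpha * (M + 1) ^+ m.
have p0 : 0 < p by rewrite mulr_gt0// exprn_gt0.
have mF : measurable_fun (eball o t) (fun y => `|F y|%:E).
  apply/measurable_EFinP; apply: measurable_funTS.
  exact: locint_measurable Inm.
have step : (p%:E * mu (large (M + 1) o t) <=
    \int[mu]_(y in eball o t) `|F y|%:E)%E.
  rewrite -(integral_cst mu mE).
  apply: (@le_trans _ _ (\int[mu]_(y in large (M + 1) o t) `|F y|%:E)%E).
    apply: ge0_le_integral; first exact: mE.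
    - by move=> y _; rewrite lee_fin ltW.
    - exact: measurable_cst.
    - by apply: measurable_funS mF; [exact: mB|exact: subIsetl].
    - move=> y [yB yM]; rewrite lee_fin /F iter_multiplierE ft// normrM normrX.
      rewrite ger0_norm ?(ltW tp)// ler_wpM2l ?(ltW tp)//.
      by rewrite lerXn2r ?nnegrE ?(ltW M1)// ltW.
  apply: ge0_subset_integral.
  - exact: mE.
  - exact: mB.
  - exact: mF.
  - by move=> y _; rewrite lee_fin.
  - exact: subIsetl.
have bound : (\int[mu]_(y in eball o t) `|F y|%:E <=
    (M ^+ m * A * t `^ alpha * vol o t)%:E)%E.
  have := Hm o t t0 ot; rewrite avgE// mulrC ler_pdivrMr ?vol_gt0//.
  rewrite -lee_fin /Rintegral fineK//.
  apply: integrable_fin_num; first exact: mB.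
  exact: locint_ball Inm o t.
have := le_trans step bound.
rewrite -lee_pdivlMl// => /le_trans; apply.
rewrite lee_fin le_eqVlt; apply/orP; left; apply/eqP.
rewrite /p expr_div_n; field.
by rewrite !gt_eqF// exprn_gt0.
Qed.

(** If [T_psi] is bounded with constant [M], so is each power of it with
constant [M ^ m], whence the averages of [|psi| ^ m] over a fixed ball are
[O(M ^ m)]; letting [m] grow bounds [|psi|] on the ball. *)
Lemma multiplier_ess_bounded (alpha : R) : 0 <= alpha -> alpha <= 1 ->
  (forall o t, exists c, 0 < c /\ forall y, edist o y < t -> c <= rho y) ->
  bounded_on_bmo V alpha (multiplier psi) ->
  exists L, 0 <= L /\ {ae mu, forall x, `|psi x| <= L}.
Proof.
move=> a0 a1 rho_lb /(bounded_on_bmoP _ n_gt0 a0 a1)[M [M1 TM]].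
have M0 : 0 <= M by exact: le_trans M1.
exists (M + 1); split; first by rewrite addr_ge0.
pose o : Rn := point.
have small t : 0 < t -> rho o <= t -> mu (large (M + 1) o t) = 0.
  move=> t0 ot.
  have [c' [c'0 c'rho]] := rho_lb o (4 * t).
  pose c := Num.min 1 (c' / t).
  (* beyond distance 4t a ball of radius below t misses the support, and within
     it the radii exceed c' *)
  have c0 : 0 < c by rewrite lt_min ltr01 divr_gt0.
  have c1 : c <= 1 by rewrite ge_min lexx.
  have clear : clear_of V c o t.
    move=> y r r0 yr; have [ty|yt] := leP (4 * t) (edist o y).
      have [tr|rt] := leP t r.
        by left; apply: le_trans tr; rewrite ler_piMl// ltW.
      right=> z yz; have yzr : edist y z < r := yz.
      have : edist o y <= edist o z + edist y z.
        by rewrite (edistC y z); exact: edist_triangle.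
      move: t0 ty rt yzr; clear; move: (edist o y) (edist o z) (edist y z).
      by move=> p q d; lra.
    left; apply: le_trans (le_trans (c'rho _ yt) yr).
    by rewrite -ler_pdivlMr// ge_min lexx orbT.
  pose f y := t `^ alpha * plateau o t y.
  have If : locint f by apply: locintZ; exact: locint_plateau.
  pose A : R := 4 * n.+1%:R / c.
  have A0 : 0 < A by rewrite divr_gt0// mulr_gt0.
  have fA : bmo_le V alpha f A by exact: bmo_le_plateau.
  have iterP m : locint (iter m (multiplier psi) f) /\
      bmo_le V alpha (iter m (multiplier psi) f) (M ^+ m * A).
    elim: m => [|m [Im fm]]; first by rewrite expr0 mul1r.
    have Am : 0 < M ^+ m * A by rewrite mulr_gt0// exprn_gt0// (lt_le_trans _ M1).
    have [IS fS] := TM _ _ Im Am fm; split; first exact: IS.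
    by rewrite exprS -mulrA; exact: fS.
  have bound m : (mu (large (M + 1) o t) <=
      ((M / (M + 1)) ^+ m * (A * vol o t))%:E)%E.
    have [Im fm] := iterP m; apply: leb_large fm ot _ => //.
    by move=> y oy; rewrite /f plateau_eq1 ?mulr1// ltW.
  apply/eqP; rewrite eq_le measure_ge0 andbT.
  have q0 : 0 <= M / (M + 1) by rewrite divr_ge0// addr_ge0.
  have q1 : `|M / (M + 1)| < 1.
    by rewrite ger0_norm// ltr_pdivrMr ?ltr_wpDl// mul1r ltrDl.
  have cv : (fun m => (M / (M + 1)) ^+ m * (A * vol o t)) @ \oo --> (0 : R).
    rewrite -[X in _ --> X](mul0r (A * vol o t)).
    by apply: cvgMl; exact: cvg_expr.
  have fin : mu (large (M + 1) o t) \is a fin_num.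
    rewrite ge0_fin_numE ?measure_ge0//.
    exact: le_lt_trans (bound 0%N) (ltry _).
  rewrite -(fineK fin) lee_fin.
  rewrite -(cvg_lim (@Rhausdorff R) cv).
  apply: limr_ge; first by apply/cvg_ex; exists 0.
  apply: nearW => m.
  by rewrite -lee_fin fineK.
pose N0 := Num.truncn (rho o).
have radius (N : nat) : 0 < (N0 + N).+1%:R :> R /\ rho o <= (N0 + N).+1%:R.
  split=> //; apply: le_trans (ltW (truncnS_gt _)) _.
  by rewrite ler_nat ltnS leq_addr.
have : mu.-negligible (\bigcup_N large (M + 1) o (N0 + N).+1%:R).
  apply: negligible_bigcup => N; have [t0 ot] := radius N.
  apply/negligibleP; [exact: measurable_large|exact: small].
apply: negligibleS => y /= /negP; rewrite -ltNge => yM.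
exists (Num.truncn (edist o y)) => //; split=> //=.
apply: lt_le_trans (truncnS_gt _) _.
by rewrite ler_nat ltnS leq_addl.
Qed.

(** On the ball where the test function [f] equals [h], the image [f psi] is
[h psi]; the constant depends on [f] only through its bound [A]. *)
Lemma osc_from_test (alpha : R) (A : R) : 0 <= alpha -> alpha <= 1 -> 0 < A ->
  locint psi -> bounded_on_bmo V alpha (multiplier psi) ->
  exists C, 0 < C /\ forall f x s (h : R), locint f -> bmo_le V alpha f A ->
    0 < s -> (forall y, eball x s y -> f y = h) ->
    `|h| * mosc x s psi <= C * s `^ alpha.
Proof.
move=> a0 a1 A0 Ipsi /(bounded_on_bmoP _ n_gt0 a0 a1)[M [M1 TM]].
have M0 : 0 < M by exact: lt_le_trans M1.
exists (M * A); split; first exact: mulr_gt0.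
move=> f x s h If fA s0 fh; have [_ [osc_le _]] := TM _ _ If A0 fA.
rewrite -(moscZ x s0 h Ipsi); apply: le_trans (osc_le x s s0).
rewrite le_eqVlt; apply/orP; left; apply/eqP.
by apply: eq_mosc => y xy; rewrite /multiplier fh.
Qed.

Lemma mosc_le_bound (L : R) : locint psi ->
  {ae mu, forall x, `|psi x| <= L} ->
  forall x s, 0 < s -> mosc x s psi <= 2 * L.
Proof.
move=> Ipsi psiL x s s0; apply: le_trans (mosc_le_norm x s0 Ipsi) _.
rewrite ler_wpM2l// -[leRHS](avg_cst x s0).
apply: le_avg_ae; [exact: s0|exact: locint_norm|exact: locint_cst|by []|].
exact: psiL.
Qed.

(* The width rho x / 16 keeps the supports within rho x / 8 of x. *)
Hypothesis rho_clear : exists c, [/\ 0 < c, c <= 1 &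
  forall x, 0 < rho x -> clear_of V c x (rho x / 16)].

Lemma power_osc (alpha L : R) : 0 <= alpha -> alpha <= 1 -> 0 <= L ->
  {ae mu, forall x, `|psi x| <= L} -> bounded_on_bmo V alpha (multiplier psi) ->
  exists C, 0 < C /\ forall x s, 0 < s -> s < rho x / 2 ->
    (rho x / s) `^ alpha * mosc x s psi <= C.
Proof.
move=> a0 a1 L0 psiL bT; have Ipsi := locint_bounded mpsi psiL.
have [c [c0 c1 clear]] := rho_clear.
have A0 : 0 < 4 * n.+1%:R / c by rewrite divr_gt0// mulr_gt0.
have [C [C0 test]] := osc_from_test a0 a1 A0 Ipsi bT.
exists (16 * C + 32 * L); split; first by rewrite ltr_wpDr ?mulr_ge0// mulr_gt0.
move=> x s s0 sx; have x0 : 0 < rho x by lra.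
pose a := rho x / 16.
have a_gt0 : 0 < a by rewrite divr_gt0.
have m0 : 0 <= mosc x s psi by exact: mosc_ge0.
have p16 : (16 : R) `^ alpha <= 16 by apply: ler1_powR; rewrite ?ler1n.
have rhoE : rho x / s = 16 * (a / s) by rewrite /a; field; exact: lt0r_neq0.
have as0 : 0 <= a / s by rewrite divr_ge0// ltW.
rewrite rhoE powRM//.
(* balls wider than the plateau are comparable to rho x, and there psi bounded
   is enough *)
have [sa|a_s] := leP s a.
  have test1 : a `^ alpha * mosc x s psi <= C * s `^ alpha.
    have := test (fun y => a `^ alpha * plateau x a y) x s (a `^ alpha).
    rewrite ger0_norm ?powR_ge0//; apply.
    - by apply: locintZ; exact: locint_plateau.
    - by apply: bmo_le_plateau => //; exact: clear.
    - exact: s0.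
    - move=> y xy; rewrite plateau_eq1 ?mulr1//.
      by apply: le_trans sa; exact: ltW.
  have test2 : (a / s) `^ alpha * mosc x s psi <= C.
    have sp : 0 < s `^ alpha by exact: powR_gt0.
    rewrite -(ler_pM2r sp); apply: le_trans test1.
    rewrite mulrAC -powRM ?(ltW s0)// divfK// ?gt_eqF//.
  rewrite -mulrA; apply: (@le_trans _ _ (16 * C)).
    by apply: ler_pM; rewrite ?mulr_ge0 ?powR_ge0.
  by rewrite lerDl mulr_ge0.
have as1 : (a / s) `^ alpha <= 1.
  rewrite -[leRHS](_ : 1 `^ alpha = 1); last by rewrite powR1.
  apply: (ge0_ler_powR a0); rewrite ?nnegrE//.
  by rewrite ler_pdivrMr// mul1r ltW.
have mL := mosc_le_bound Ipsi psiL x s0.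
apply: (@le_trans _ _ (16 * 1 * (2 * L))).
  by apply: ler_pM; rewrite ?mulr_ge0 ?powR_ge0// ler_pM ?powR_ge0.
by rewrite mulr1; lra.
Qed.

Lemma log_osc (L : R) : 0 <= L ->
  {ae mu, forall x, `|psi x| <= L} -> bounded_on_bmo V 0 (multiplier psi) ->
  exists C, 0 < C /\ forall x s, 0 < s -> s < rho x / 2 ->
    ln (rho x / s) * mosc x s psi <= C.
Proof.
move=> L0 psiL bT; have Ipsi := locint_bounded mpsi psiL.
have [c [c0 c1 clear]] := rho_clear.
have A0 : 0 < 16 * n.+1%:R / c by rewrite divr_gt0// mulr_gt0.
have [C [C0 test]] := osc_from_test (lexx 0) (ler01) A0 Ipsi bT.
exists (5 * C + 8 * L); split; first by rewrite ltr_wpDr ?mulr_ge0// mulr_gt0.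
move=> x s s0 sx; have x0 : 0 < rho x by lra.
pose a := rho x / 16.
have a_gt0 : 0 < a by rewrite divr_gt0.
have m0 : 0 <= mosc x s psi by exact: mosc_ge0.
have us0 : 0 < rho x / s by rewrite divr_gt0.
(* ln is at most the dyadic exponent, as ln 2 <= 1 *)
have ln_le (k : nat) : rho x / s <= 2 ^+ k -> ln (rho x / s) <= k%:R.
  move=> uk; apply: (@le_trans _ _ (ln (2 ^+ k))).
    by rewrite ler_ln ?posrE ?exprn_gt0.
  rewrite lnXn// lerMn2r; apply/orP; right.
  by apply: (@le_ln1Dx R 1); rewrite (lt_trans (ltrN10 R)).
have [sa|a_s] := leP s a.
  have as1 : 1 <= a / s by rewrite ler_pdivlMr// mul1r.
  have [k /andP[k1 k2]] := dyadic_scale as1.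
  have lnk : ln (rho x / s) <= (k.+1 + 4)%:R.
    apply: ln_le; rewrite exprD (_ : rho x / s = a / s * 16); last first.
      by rewrite /a; field; exact: lt0r_neq0.
    apply: ler_pM => //; [by rewrite divr_ge0 // ltW|exact: ltW|].
    by rewrite -natrX ler_nat.
  have test1 : k.+1%:R * mosc x s psi <= C.
    have := test (staircase x a k.+1) x s k.+1%:R.
    rewrite powRr0 mulr1 ger0_norm//; apply.
    - exact: locint_staircase.
    - by apply: bmo_le_staircase => //; exact: clear.
    - exact: s0.
    - move=> y xy; apply: staircase_eq => //=.
      apply: le_trans (ltW xy) _.
      by rewrite ler_pdivlMr ?exprn_gt0// mulrC -ler_pdivlMr.
  apply: (@le_trans _ _ ((5 * k.+1%:R) * mosc x s psi)).
    rewrite ler_wpM2r//; apply: le_trans lnk _.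
    by rewrite -natrM ler_nat (mulSn 4) leq_add2l leq_pmulr.
  by rewrite -mulrA; move: (k.+1%:R * _) test1 => p pC; lra.
have ln4 : ln (rho x / s) <= 4.
  apply: (ln_le 4%N); rewrite -natrX ler_pdivrMr//.
  by move: a_s; rewrite /a -[(2 ^ 4)%N]/16%N; lra.
have mL := mosc_le_bound Ipsi psiL x s0.
apply: (@le_trans _ _ (4 * (2 * L))).
  apply: (@le_trans _ _ (4 * mosc x s psi)); first by rewrite ler_wpM2r.
  by rewrite ler_wpM2l.
by rewrite mulrA -natrM ler_wpDl// mulr_ge0// ltW.
Qed.

End necessity.

(** * Critical radii of a reverse Hoelder potential *)

Section critical_radii.
Context {R : realType} {n : nat}.
Local Notation Rn := (Rn R n).
Local Notation mu := (leb R n).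
Implicit Types (x y z o : Rn) (r s t c : R).
Variables (V : Rn -> R) (q : R).
Hypothesis n_ge3 : (3 <= n)%N.
Hypothesis V_ge0 : forall x, 0 <= V x.
Hypothesis V_int : locint V.
Hypothesis V_neq0 : ~ {ae mu, forall x, V x = 0}.
Hypothesis hq : n%:R / 2 <= q.
Hypothesis V_RH : reverse_holder q V.
Local Notation rho := (critical_radius V).

Let W (x : Rn) : R := V x `^ q.

Let W_ge0 x : 0 <= W x. Proof. exact: powR_ge0. Qed.

Let q_gt1 : 1 < q.
Proof.
apply: lt_le_trans hq; rewrite ltr_pdivlMr// mul1r (ltr_nat R 2 n).
exact: n_ge3.
Qed.

Let q_gt0 : 0 < q. Proof. exact: lt_trans q_gt1. Qed.

Let measurable_W : measurable_fun [set: Rn] W.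
Proof.
exact: (measurableT_comp (measurable_powR q) (locint_measurable V_int)).
Qed.

(** A finite right-hand side in the reverse Hoelder inequality makes [V ^ q]
locally integrable. *)
Lemma locint_RH : locint W.
Proof.
have [C RH] := V_RH.
apply: LocInt => [//|x r]; have [r0|r0] := leP r 0.
  by rewrite eball_le0//; exact: integrable_set0.
have mW : measurable_fun (eball x r) (EFin \o W).
  by apply/measurable_EFinP; exact: measurable_funTS.
apply/integrableP; split; first exact: mW.
have : (eavg (eball x r) W < +oo)%E.
  apply: (@lty_poweRy _ _ q^-1); first by rewrite invr_neq0// gt_eqF.
  by apply: le_lt_trans (RH x r r0) _; rewrite eavgE// -EFinM ltry.
rewrite eavg_ballE// -lte_pdivlMl; last by rewrite invr_gt0 vol_gt0.
rewrite muleC invrK => h.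
rewrite (eq_integral (fun y => (W y)%:E)).
  by apply: lt_le_trans h _; rewrite leey.
by move=> y _ /=; rewrite ger0_norm.
Qed.

Lemma RH_avg : exists C, 1 <= C /\ forall x r, 0 < r ->
  (avg (eball x r) W) `^ q^-1 <= C * avg (eball x r) V.
Proof.
have [C RH] := V_RH; exists (Num.max 1 C).
split=> [|x r r0]; first by rewrite le_max lexx.
have := RH x r r0; rewrite !eavgE//; last exact: locint_RH.
rewrite poweR_EFin -EFinM lee_fin => /le_trans; apply.
by rewrite ler_wpM2r ?avg_ge0// le_max lexx orbT.
Qed.

(** Young's inequality with a free level [l], the trivial bound below [l] and
[v ^ (1 - q) <= l ^ (1 - q)] above it. *)
Lemma young_level (l v : R) : 0 < l -> 0 <= v -> v <= l + l `^ (1 - q) * v `^ q.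
Proof.
move=> l0 v0; have [vl|lv] := leP v l.
  by apply: le_trans vl _; rewrite lerDl mulr_ge0// powR_ge0.
have vp : 0 < v by exact: lt_trans lv.
apply: (@le_trans _ _ (l `^ (1 - q) * v `^ q)); last by rewrite lerDr ltW.
apply: (@le_trans _ _ (v `^ (1 - q) * v `^ q)).
  rewrite -powRD; last by rewrite (gt_eqF vp) implybT.
  by rewrite subrK powRr1.
rewrite ler_wpM2r ?powR_ge0// -[1 - q]opprB !powRN lef_pV2 ?posrE ?powR_gt0//.
apply: ge0_ler_powR; rewrite ?nnegrE ?subr_ge0; exact: ltW.
Qed.

Lemma young_integral (l : R) x r (E : set Rn) : 0 < l -> 0 < r ->
  measurable E -> E `<=` eball x r ->
  \int[mu]_(y in E) V y <=
    l * fine (mu E) + l `^ (1 - q) * \int[mu]_(y in E) W y.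
Proof.
move=> l0 r0 mE EB; have mB := @measurable_eball R n x r.
have IV : mu.-integrable E (EFin \o V).
  exact: integrableS mB mE EB (locint_ball V_int x r).
have IW : mu.-integrable E (EFin \o W).
  exact: integrableS mB mE EB (locint_ball locint_RH x r).
have Il : mu.-integrable E (EFin \o cst l).
  exact: integrableS mB mE EB (locint_ball (locint_cst l) x r).
have IlW : mu.-integrable E (EFin \o (fun y => l `^ (1 - q) * W y)).
  exact: integrableS mB mE EB (locint_ball (locintZ _ locint_RH) x r).
rewrite -(Rintegral_cst mu mE l) -(RintegralZl _ mE IW) -(RintegralD mE Il IlW).
apply: (le_Rintegral mE IV) => [|y _].
  exact: (integrableD mE Il IlW).
exact: young_level.
Qed.

(** Hoelder's inequality, up to the factor two lost in optimising the level. *)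
Lemma avg_le_root x r : 0 < r ->
  avg (eball x r) V <= 2 * (avg (eball x r) W) `^ q^-1.
Proof.
move=> r0; set a := avg _ V; set b := avg _ W.
have b0 : 0 <= b by exact: avg_ge0.
have key l : 0 < l -> a <= l + l `^ (1 - q) * b.
  move=> l0; rewrite -[X in _ <= X + _](avg_cst x r0 l) /b -avgZ//; last exact: locint_RH.
  rewrite -avgD; [|exact: r0|exact: locint_cst|exact: (locintZ _ locint_RH)].
  apply: le_avg; [exact: r0|exact: V_int| |by move=> y _; exact: young_level].
  by apply: locintD; [exact: locint_cst|exact: (locintZ _ locint_RH)].
have [b00|bn0] := eqVneq b 0.
  rewrite b00 powR0 ?mulr0 ?invr_neq0 ?gt_eqF//.
  apply/ler_addgt0Pr => e e0; rewrite add0r; have := key _ e0.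
  by rewrite b00 mulr0 addr0.
have bp : 0 < b by rewrite lt0r bn0.
have l0 : 0 < b `^ q^-1 by exact: powR_gt0.
apply: le_trans (key _ l0) _.
rewrite mulr_natl mulr2n lerD2l -powRrM -{2}[b]powRr1// -powRD; last first.
  by rewrite bn0 implybT.
by rewrite mulrBr mulr1 mulVf ?gt_eqF// subrK.
Qed.

(** The bookkeeping of [RH_shrink], with [k * p] bounding the three terms that
are absorbed. *)
Let shrink_arith (C k Q L p w w' wB vA vB a b : R) :
  0 < C -> 0 < k -> C * k = 4^-1 -> 0 < L -> L * w = p ->
  w = w' + wB -> 0 <= wB ->
  vA <= a + k * L * w' -> a <= k * p ->
  vB <= b + Q * L * wB -> b <= k * p ->
  p <= C * (vA + vB) -> w <= 4 * C * Q * wB.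
Proof.
move=> C0 k0 Ck L0 Lw splitw wB0 hA ha hB hb hp.
have e : k * (L * w') <= k * p by rewrite ler_pM2l// -Lw ler_pM2l//; lra.
have h : C * (vA + vB) <= C * (3 * (k * p) + Q * L * wB).
  by rewrite ler_pM2l//; lra.
rewrite (_ : C * (3 * (k * p) + Q * L * wB) =
  3 * (C * k) * p + C * Q * L * wB) in h; last by ring.
rewrite Ck in h.
rewrite -(ler_pM2l L0) Lw.
rewrite (_ : L * _ = 4 * (C * Q * L * wB)); last by ring.
lra.
Qed.

(** A small concentric ball carries only part of the mass of [V ^ q]: were
almost all of it there, [V] would have too small an average for the reverse
Hoelder inequality. *)
Lemma RH_shrink : exists th d : R, [/\ 0 < th, th <= 1, 0 < d, d <= 1 &
  forall y r, 0 < r ->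
  \int[mu]_(z in eball y (th * r)) W z <=
  (1 - d) * \int[mu]_(z in eball y r) W z].
Proof.
have [C [C1 RH]] := RH_avg.
have C0 : 0 < C by exact: lt_le_trans C1.
have q10 : q - 1 != 0 by rewrite subr_eq0 gt_eqF.
(* Young's inequality is used at level K * l on the small ball and k * l on its
   complement, l being the L^q average; K and k make each term at most a quarter of the
   whole, except the one with the mass of V ^ q on the complement *)
pose k := (4 * C)^-1.
pose K := (4 * C) `^ (q - 1)^-1.
have C40 : 0 < 4 * C by rewrite mulr_gt0.
have k0 : 0 < k by rewrite invr_gt0.
have K0 : 0 < K by exact: powR_gt0.
have KE : K `^ (1 - q) = k.
  by rewrite /K -powRrM -[1 - q]opprB mulrN mulVf// powR_inv1// ltW.
pose N : R := n.+1%:R ^+ n.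
have N1 : 1 <= N by rewrite exprn_ege1// ler1n.
have N0 : 0 < N by exact: lt_le_trans N1.
(* the volume ratio beats the factor K of the high level *)
pose th := Num.min 1 (k / (N * K)).
have th0 : 0 < th by rewrite lt_min ltr01 divr_gt0// mulr_gt0.
have th1 : th <= 1 by rewrite ge_min lexx.
have thK : K * (N * th ^+ n) <= k.
  rewrite mulrA -ler_pdivlMl ?mulr_gt0//.
  apply: (@le_trans _ _ th).
    by rewrite -[leRHS]expr1 ler_wiXn2l// ?(ltW th0)// (leq_trans _ n_ge3).
  by rewrite mulrC (mulrC K) ge_min lexx orbT.
pose d := k * k `^ (q - 1).
have kq : 0 < k `^ (q - 1) by exact: powR_gt0.
have k1 : k <= 1 by rewrite invf_le1//; lra.
have d0 : 0 < d by rewrite mulr_gt0.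
have d1 : d <= 1.
  rewrite /d -[leRHS](mulr1 1) ler_pM ?(ltW k0) ?(ltW kq)//.
  rewrite -[leRHS](powRr0 k) ger_powR ?k0//.
  by rewrite subr_ge0 ltW.
exists th, d; split=> // y r r0.
have tr0 : 0 < th * r by rewrite mulr_gt0.
have sub : eball y (th * r) `<=` eball y r.
  by apply: sub_eball; rewrite edistxx add0r ler_piMl// ltW.
have mB := @measurable_eball R n y r.
have mB' := @measurable_eball R n y (th * r).
have mE : measurable (eball y r `\` eball y (th * r)) by exact: measurableD.
have union : eball y (th * r) `|` (eball y r `\` eball y (th * r)) = eball y r.
  exact: setDUK.
have disj : [disjoint eball y (th * r) & eball y r `\` eball y (th * r)].
  by rewrite disj_set2E setDIK.
have split_int (f : Rn -> R) : locint f -> \int[mu]_(z in eball y r) f z =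
    \int[mu]_(z in eball y (th * r)) f z +
    \int[mu]_(z in eball y r `\` eball y (th * r)) f z.
  move=> If; rewrite -[X in \int[mu]_(z in X) f z]union Rintegral_setU//.
  by rewrite union; exact: locint_ball.
have volE : fine (mu (eball y r `\` eball y (th * r))) <= vol y r.
  apply: fine_le.
  - rewrite ge0_fin_numE ?measure_ge0//.
    apply: le_lt_trans (le_lt_trans (leb_eball_le y r0) (ltry _)).
    by apply: le_measure; rewrite ?inE; [exact: mE|exact: mB|exact: subDsetl].
  - by rewrite leb_eballE.
  - by apply: le_measure; rewrite ?inE; [exact: mE|exact: mB|exact: subDsetl].
have vol' : vol y (th * r) <= N * th ^+ n * vol y r.
  apply: le_trans (vol_ratio y y tr0 r0) _.
  by rewrite mulfK ?gt_eqF// exprMn.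
have v0 := vol_gt0 y r0.
set m1 := vol y r in v0 volE vol'.
set w := \int[mu]_(z in eball y r) W z.
set w' := \int[mu]_(z in eball y (th * r)) W z.
have w0 : 0 <= w by exact: Rintegral_ge0.
have w'0 : 0 <= w' by exact: Rintegral_ge0.
have splitW := split_int _ locint_RH; rewrite -/w -/w' in splitW.
have wE0 : 0 <= \int[mu]_(z in eball y r `\` eball y (th * r)) W z.
  exact: Rintegral_ge0.
have [wz|wn0] := eqVneq w 0.
  by rewrite wz mulr0 -wz splitW lerDl.
have wp : 0 < w by rewrite lt0r wn0.
set l := (w / m1) `^ q^-1.
have l0 : 0 < l by rewrite powR_gt0// divr_gt0.
have lq : l `^ q * m1 = w.
  rewrite /l -powRrM mulVf ?gt_eqF// powRr1 ?divfK ?gt_eqF//.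
  by rewrite divr_ge0// ltW.
have lq1 : l `^ (1 - q) * w = l * m1.
  rewrite -lq mulrA -powRD; last by rewrite (gt_eqF l0) implybT.
  by rewrite subrK powRr1// ltW.
have RHl : l * m1 <= C * \int[mu]_(z in eball y r) V z.
  have := RH y r r0; rewrite !avgE//; last exact: locint_RH.
  rewrite -/w -/m1 [_^-1 * w]mulrC -/l mulrCA [X in _ <= X]mulrC.
  by rewrite ler_pdivlMr.
have I1 := young_integral (mulr_gt0 K0 l0) r0 mB' sub.
have I2 := young_integral (mulr_gt0 k0 l0) r0 mE (@subDsetl _ _ _).
rewrite (split_int _ V_int) in RHl.
move: I1 I2 RHl; rewrite -/(vol y (th * r)) -/w'.
rewrite !powRM ?(ltW K0) ?(ltW k0) ?(ltW l0)// KE.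
move: splitW wE0.
set vA := \int[mu]_(z in eball y (th * r)) V z.
set vB := \int[mu]_(z in _ `\` _) V z.
set wB := \int[mu]_(z in _ `\` _) W z.
move=> splitW wB0 I1 I2 RHl.
have e1 : K * l * vol y (th * r) <= k * (l * m1).
  apply: (@le_trans _ _ (K * l * (N * th ^+ n * m1))).
    by rewrite ler_wpM2l// mulr_ge0// ltW.
  rewrite (_ : K * l * _ = K * (N * th ^+ n) * (l * m1)); last by ring.
  by rewrite ler_wpM2r// mulr_ge0// ltW.
have e2 : k * l * fine (mu (eball y r `\` eball y (th * r))) <= k * (l * m1).
  by rewrite -mulrA ler_wpM2l ?(ltW k0)// ler_wpM2l ?(ltW l0).
have kC : C * k = 4^-1.
  by rewrite /k invfM mulrCA divff ?mulr1// gt_eqF.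
have lpp : 0 < l `^ (1 - q) by exact: powR_gt0.
have J := shrink_arith C0 k0 kC lpp lq1 splitW wB0 I1 e1 I2 e2 RHl.
have dC : d * (4 * C * k `^ (1 - q)) = 1.
  rewrite /d -[1 - q]opprB powRN (_ : 4 * C = k^-1); last by rewrite invrK.
  by field; rewrite !gt_eqF.
have dw : d * w <= wB.
  have := ler_wpM2l (ltW d0) J.
  by rewrite [X in _ <= X]mulrA dC mul1r.
rewrite mulrBl mul1r lerBrDr -lerBrDl.
by rewrite [X in X - _]splitW addrAC subrr add0r.
Qed.

Let mass_V x r := \int[mu]_(y in eball x r) V y.
Let mass_W x r := \int[mu]_(y in eball x r) W y.

Let mass_W_ge0 x r : 0 <= mass_W x r. Proof. exact: Rintegral_ge0. Qed.
Let mass_V_ge0 x r : 0 <= mass_V x r. Proof. exact: Rintegral_ge0. Qed.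

Let mass_sub (f : Rn -> R) x r y s : locint f -> (forall z, 0 <= f z) ->
  eball y s `<=` eball x r ->
  \int[mu]_(z in eball y s) f z <= \int[mu]_(z in eball x r) f z.
Proof.
move=> If f0 sub; apply: fine_le.
- apply: integrable_fin_num; first exact: measurable_eball.
  exact: locint_ball.
- apply: integrable_fin_num; first exact: measurable_eball.
  exact: locint_ball.
- apply: ge0_subset_integral.
  + exact: measurable_eball.
  + exact: measurable_eball.
  + apply/measurable_EFinP; apply: measurable_funTS; exact: locint_measurable.
  + by move=> z _; rewrite lee_fin.
  + exact: sub.
Qed.

Let inv_q01 : 0 <= q^-1 <= 1.
Proof. by rewrite invr_ge0 (ltW q_gt0) invf_le1// ltW. Qed.

(** Hoelder's inequality on the small ball and the reverse one on the large ball
give the factor [(s / R') ^ (n - n / q)], and [n - n / q >= n - 2] because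
[q >= n / 2]. *)
Lemma mass_compare : exists K, 0 < K /\ forall x R' y s (eta : R),
  0 < s -> s <= R' -> 0 <= eta -> mass_W y s <= eta * mass_W x R' ->
  mass_V y s <= K * eta `^ q^-1 * (s / R') ^+ (n - 2) * mass_V x R'.
Proof.
have [C [C1 RH]] := RH_avg; have C0 : 0 < C by exact: lt_le_trans C1.
pose N : R := n.+1%:R ^+ n.
have N1 : 1 <= N by rewrite exprn_ege1// ler1n.
have N0 : 0 < N by exact: lt_le_trans N1.
have /andP[p0 p1] := inv_q01.
exists (2 * C * N); split=> [|x R' y s eta s0 sR eta0 wsR]; first by rewrite !mulr_gt0.
have R0 : 0 < R' by exact: lt_le_trans sR.
have X0 := vol_gt0 y s0; have Y0 := vol_gt0 x R0.
have XY : vol y s <= N * (s / R') ^+ n * vol x R'.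
  by rewrite -exprMn; exact: vol_ratio.
have := RH x R' R0; have := avg_le_root y s0.
rewrite !avgE//; try exact: locint_RH.
rewrite -/(mass_V y s) -/(mass_W y s) -/(mass_V x R') -/(mass_W x R').
move: (mass_W_ge0 y s) (mass_W_ge0 x R') (mass_V_ge0 x R') wsR X0 Y0 XY.
move: (mass_W y s) (mass_W x R') (mass_V x R') (mass_V y s) => ws wR vR vs.
move: (vol y s) (vol x R') => X Y ws0 wR0 vR0 wsR X0 Y0 XY h1 h2.
set p := q^-1 in p0 p1 h1 h2 *.
have YX0 : 0 <= Y / X by rewrite divr_ge0// ltW.
have step1 : (X^-1 * ws) `^ p <= eta `^ p * (C * (Y^-1 * vR)) * (Y / X) `^ p.
  apply: (@le_trans _ _ ((eta * (Y^-1 * wR) * (Y / X)) `^ p)).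
    apply: (ge0_ler_powR p0).
    - by rewrite nnegrE mulr_ge0// invr_ge0 ltW.
    - by rewrite nnegrE !mulr_ge0 ?invr_ge0 ?(ltW X0) ?(ltW Y0).
    rewrite (_ : eta * _ * _ = X^-1 * (eta * wR)).
      by rewrite ler_pM2l// invr_gt0.
    by field; rewrite !gt_eqF.
  rewrite !powRM ?mulr_ge0 ?invr_ge0 ?(ltW X0) ?(ltW Y0)//.
  rewrite ler_wpM2r ?mulr_ge0 ?powR_ge0// ler_wpM2l ?powR_ge0//.
  by apply: le_trans h2; rewrite powRM// invr_ge0 ltW.
have step2 : vs <= 2 * C * eta `^ p * vR * (X / Y * (Y / X) `^ p).
  move: h1; rewrite ler_pdivrMl// => /le_trans; apply.
  apply: (@le_trans _ _
      (X * (2 * (eta `^ p * (C * (Y^-1 * vR)) * (Y / X) `^ p)))).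
    by rewrite ler_wpM2l ?(ltW X0)// ler_wpM2l.
  by rewrite le_eqVlt; apply/orP; left; apply/eqP; ring.
apply: le_trans step2 _.
have step3 : X / Y * (Y / X) `^ p <= N * (s / R') ^+ (n - 2).
  have u0 : 0 < X / Y by rewrite divr_gt0.
  have t0 : 0 < s / R' by rewrite divr_gt0.
  have t1 : s / R' <= 1 by rewrite ler_pdivrMr// mul1r.
  have p10 : 0 <= 1 - p by rewrite subr_ge0.
  have -> : Y / X = (X / Y) `^ (-1) by rewrite powR_inv1 ?invf_div ?(ltW u0).
  rewrite -powRrM mulN1r.
  rewrite -{1}[X / Y]powRr1 ?(ltW u0)// -powRD; last by rewrite (gt_eqF u0) implybT.
  apply: (@le_trans _ _ ((N * (s / R') ^+ n) `^ (1 - p))).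
    apply: (ge0_ler_powR p10).
    - by rewrite nnegrE ltW.
    - by rewrite nnegrE mulr_ge0 ?exprn_ge0 ?(ltW t0) ?(ltW N0).
    - by rewrite ler_pdivrMr.
  rewrite powRM ?exprn_ge0 ?(ltW t0) ?(ltW N0)//.
  apply: ler_pM; rewrite ?powR_ge0//.
    by apply: ler1_powR => //; rewrite gerBl.
  rewrite -!powR_mulrn ?(ltW t0)// -powRrM ger_powR ?t0//.
  rewrite natrB; last by rewrite (leq_trans _ n_ge3).
  rewrite mulrBr mulr1 lerB// /p ler_pdivrMr//.
  by rewrite mulrC -ler_pdivrMr.
have cst0 : 0 <= 2 * C * eta `^ p * vR by rewrite !mulr_ge0 ?powR_ge0// ltW.
have := ler_wpM2l cst0 step3.
move=> /le_trans; apply.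
by rewrite le_eqVlt; apply/orP; left; apply/eqP; ring.
Qed.

Let Phi x r : R := r ^- (n - 2) * mass_V x r.

(** In [mass_compare] the power of [s / R'] only restores scale invariance when
[q = n / 2]; the decay comes from the factor [eta], which [RH_shrink] makes small
when iterated. *)
Lemma Phi_decay (eps : R) : 0 < eps -> exists c, [/\ 0 < c, c <= 1 &
  forall x y R' s, 0 < R' -> edist x y < R' / 2 -> 0 < s -> s <= c * R' ->
    Phi y s <= eps * Phi x R'].
Proof.
move=> eps0; have [K [K0 comp]] := mass_compare.
have [th [d [th0 th1 d0 d1 shrink]]] := RH_shrink.
have iterW k y r : 0 < r -> mass_W y (th ^+ k * r) <= (1 - d) ^+ k * mass_W y r.
  move=> r0; elim: k => [|k IHk]; first by rewrite !expr0 !mul1r.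
  have tkr : 0 < th ^+ k * r by rewrite mulr_gt0// exprn_gt0.
  rewrite exprS -mulrA; apply: le_trans (shrink y _ tkr) _.
  by rewrite exprS -mulrA ler_wpM2l// subr_ge0.
have /andP[p0 p1] := inv_q01.
have q'0 : 0 <= 1 - d by rewrite subr_ge0.
have q'1 : `|1 - d| < 1 by rewrite ger0_norm// ltrBlDr ltrDl.
have eta0 : 0 < (eps / K) `^ q by rewrite powR_gt0// divr_gt0.
have [k dk] : exists k, (1 - d) ^+ k <= (eps / K) `^ q.
  have := cvg_expr q'1; move/cvgrPdist_le => /(_ _ eta0)[k _ /(_ k (leqnn k))].
  by rewrite /= sub0r normrN ger0_norm ?exprn_ge0//; exists k.
have thk1 : th ^+ k <= 1 by apply: exprn_ile1 => //; exact: ltW.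
exists (th ^+ k / 2); split.
- by rewrite divr_gt0// exprn_gt0.
- by rewrite ler_pdivrMr// mul1r (le_trans thk1)// ler1n.
move=> x y R' s R0 xy s0 sR.
have R20 : 0 < R' / 2 by rewrite divr_gt0.
have sR' : s <= R'.
  apply: le_trans sR _; rewrite ler_piMl ?(ltW R0)//.
  by rewrite ler_pdivrMr// mul1r (le_trans thk1)// ler1n.
have subs : eball y s `<=` eball y (th ^+ k * (R' / 2)).
  apply: sub_eball; rewrite edistxx add0r.
  by apply: le_trans sR _; rewrite mulrA mulrAC.
have subR : eball y (R' / 2) `<=` eball x R'.
  apply: sub_eball; apply: (@le_trans _ _ (R' / 2 + R' / 2)); last by rewrite -splitr.
  by rewrite lerD2r ltW.
have wsR : mass_W y s <= (eps / K) `^ q * mass_W x R'.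
  apply: le_trans (mass_sub locint_RH W_ge0 subs) _.
  apply: le_trans (iterW _ _ _ R20) _.
  apply: ler_pM; [by rewrite exprn_ge0|exact: mass_W_ge0|exact: dk|].
  exact: mass_sub locint_RH W_ge0 subR.
have := comp x R' y s _ s0 sR' (ltW eta0) wsR.
rewrite -powRrM divff ?gt_eqF// powRr1 ?divr_ge0 ?(ltW eps0) ?(ltW K0)//.
rewrite mulrCA divff ?gt_eqF// mulr1 => h.
rewrite /Phi; have sn : 0 < s ^- (n - 2) by rewrite invr_gt0 exprn_gt0.
have := ler_wpM2l (ltW sn) h; move=> /le_trans; apply.
rewrite le_eqVlt; apply/orP; left; apply/eqP.
rewrite expr_div_n; field.
by rewrite !gt_eqF// exprn_gt0.
Qed.

Let Phi_le1E x r : 0 < r ->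
  ((r ^- (n - 2))%:E * \int[mu]_(y in eball x r) (V y)%:E <= 1)%E =
  (Phi x r <= 1).
Proof.
move=> r0; rewrite /Phi /mass_V /Rintegral -lee_fin EFinM fineK//.
apply: integrable_fin_num; first exact: measurable_eball.
exact: locint_ball.
Qed.

Let Phi_ge0 x r : 0 < r -> 0 <= Phi x r.
Proof.
by move=> r0; rewrite mulr_ge0 ?mass_V_ge0// invr_ge0 exprn_ge0// ltW.
Qed.

Let Phi_pos x : exists2 r, 0 < r & 0 < Phi x r.
Proof.
apply: contrapT => Phi0; apply: V_neq0.
have zero (k : nat) : \int[mu]_(y in eball x k.+1%:R) V y = 0.
  apply/eqP; rewrite eq_le -/(mass_V x k.+1%:R) mass_V_ge0 andbT leNgt.
  apply/negP => m0; apply: Phi0; exists k.+1%:R => //.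
  by rewrite mulr_gt0// invr_gt0 exprn_gt0.
have neg : mu.-negligible (\bigcup_k (eball x k.+1%:R `&` [set y | V y != 0])).
  apply: negligible_bigcup => k.
  have mB := @measurable_eball R n x k.+1%:R.
  have mV : measurable_fun (eball x k.+1%:R) (EFin \o V).
    apply/measurable_EFinP; apply: measurable_funTS.
    exact: locint_measurable V_int.
  have : (\int[mu]_(y in eball x k.+1%:R) `|(V y)%:E| = 0)%E.
    rewrite (eq_integral (fun y => (V y)%:E)); last first.
      by move=> y _; rewrite gee0_abs// lee_fin.
    have fin : (\int[mu]_(y in eball x k.+1%:R) (V y)%:E)%E \is a fin_num.
      apply: integrable_fin_num; first exact: mB.
      exact: locint_ball.
    by rewrite -(fineK fin) -[fine _]/(\int[mu]_(y in eball x k.+1%:R) V y) zero.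
  move/(ae_eq_integral_abs mu mB mV); rewrite /ae_eq; apply: negligibleS.
  move=> y /= [yB Vy] h; move/eqP : Vy; apply.
  by have := h yB => -[].
apply: negligibleS neg => y /= Vy.
exists (Num.truncn (edist x y)) => //; split; last exact/eqP.
exact: truncnS_gt.
Qed.

Let rho_set x := [set r | 0 < r /\
  ((r ^- (n - 2))%:E * \int[mu]_(y in eball x r) (V y)%:E <= 1)%E].

(** If [Phi x s <= 1] for arbitrarily large [s], decay would force [Phi x r = 0]
for all [r], that is [V = 0] almost everywhere. *)
Let rho_set_ub x : has_ubound (rho_set x).
Proof.
have [r r0 Phir] := Phi_pos x.
have [c [c0 c1 decay]] := Phi_decay (divr_gt0 Phir (ltr0Sn R 1)).
exists (r / c) => s [s0]; rewrite Phi_le1E// => Ps.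
rewrite leNgt; apply/negP => rs.
have rcs : r <= c * s by rewrite mulrC -ler_pdivrMr// ltW.
have xx : edist x x < s / 2 by rewrite edistxx divr_gt0.
have h1 := decay x x s r s0 xx r0 rcs.
have h2 : Phi x r / 2 * Phi x s <= Phi x r / 2.
  by rewrite ler_piMr// divr_ge0// ltW.
by have := le_trans h1 h2; rewrite leNgt ltr_pdivrMr// ltr_pMr// ltr1n.
Qed.

Lemma critical_radius_ge x s : 0 < s -> Phi x s <= 1 -> s <= rho x.
Proof.
by move=> s0 Ps; apply: (ub_le_sup (rho_set_ub x)); split; rewrite ?Phi_le1E.
Qed.

Lemma critical_radius_gt x : 0 < rho x ->
  exists r, [/\ 0 < r, rho x / 2 < r & Phi x r <= 1].
Proof.
move=> x0; have [||r [r0 Pr] xr] := @sup_gt _ (rho_set x) (rho x / 2) _ _.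
- apply: contrapT => /set0P/negP/negPn/eqP e.
  by move: x0; rewrite /critical_radius -/(rho_set x) e sup0 ltxx.
- by rewrite -[sup _]/(rho x) ltr_pdivrMr// ltr_pMr// ltr1n.
by exists r; split=> //; rewrite -Phi_le1E.
Qed.

Lemma critical_radius_lb o t :
  exists c, 0 < c /\ forall y, edist o y < t -> c <= rho y.
Proof.
pose R' := 2 * (`|t| + 1).
have R0 : 0 < R' by rewrite mulr_gt0// ltr_wpDl.
have P0 : 0 < Phi o R' + 1 by rewrite ltr_wpDl// Phi_ge0.
have PV : 0 < (Phi o R' + 1)^-1 by rewrite invr_gt0.
have [c [c0 c1 decay]] := Phi_decay PV.
exists (c * R'); split=> [|y oy]; first exact: mulr_gt0.
have cR0 : 0 < c * R' by exact: mulr_gt0.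
apply: critical_radius_ge => //.
have oyR : edist o y < R' / 2.
  rewrite /R' mulrC mulKf// (lt_le_trans oy)//.
  by rewrite (le_trans (ler_norm t))// lerDl.
apply: le_trans (decay o y R' _ R0 oyR cR0 (lexx _)) _.
by rewrite ler_pdivrMl// mulr1 lerDl.
Qed.

(** Near [x], within a quarter of [rho x], the decay of [Phi] bounds the critical
radii below by a multiple of [rho x]; a ball centred farther away has to be large
to come close to [x]. *)
Lemma critical_radius_clear : exists c, [/\ 0 < c, c <= 1 &
  forall x, 0 < rho x -> clear_of V c x (rho x / 16)].
Proof.
have [c [c0 c1 decay]] := Phi_decay ltr01.
exists c; split=> // x x0 y r r0 yr.
have [xy|yx] := ltP (edist x y) (rho x / 4).
  left; have [R' [R0 xR PR]] := critical_radius_gt x0.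
  have cR0 : 0 < c * R' by exact: mulr_gt0.
  have xyR : edist x y < R' / 2.
    apply: lt_trans xy _; rewrite ltr_pdivlMr//.
    by rewrite (_ : rho x / 4 * 2 = rho x / 2)//; field.
  have PcR : Phi y (c * R') <= 1.
    apply: le_trans (decay x y R' _ R0 xyR cR0 (lexx _)) _.
    by rewrite mul1r.
  apply: le_trans (le_trans (critical_radius_ge cR0 PcR) yr).
  rewrite ler_pM2l//; apply: ltW; apply: le_lt_trans xR.
  by rewrite ler_pM2l// lef_pV2 ?posrE// ler_nat.
have [xr|rx] := leP (rho x / 16) r.
  by left; apply: le_trans xr; rewrite ler_piMl// divr_ge0// ltW.
right=> z yz; have yzr : edist y z < r := yz.
have : edist x y <= edist x z + edist y z.
  by rewrite (edistC y z); exact: edist_triangle.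
move: x0 yx rx yzr; move: (edist x y) (edist x z) (edist y z) (rho x) => e f g h.
lra.
Qed.

End critical_radii.

(** * The multiplier theorem *)

(** The space [R^n] has positive measure, so the [L^oo] norm is the essential
supremum. *)
Lemma LfunyP {R : realType} {n : nat} (psi : Rn R n -> R) :
  (0 < n)%N -> measurable_fun [set: Rn R n] psi ->
  psi \in Lfun (leb R n) +oo%E <->
  exists L, 0 <= L /\ {ae leb R n, forall x, `|psi x| <= L}.
Proof.
move=> n0 mpsi.
have muT : (0 < leb R n [set: Rn R n])%E.
  have mB := @measurable_eball R n point 1.
  apply: (@lt_le_trans _ _ (leb R n (eball point 1))).
    by rewrite leb_eballE// lte_fin vol_gt0.
  by apply: le_measure; rewrite ?inE; [exact: mB|exact: measurableT|].
have normE : 'N[leb R n]_+oo [EFin \o psi]%E =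
    ess_sup (leb R n) (abse \o (EFin \o psi)).
  by rewrite unlock muT.
split=> [/andP[_]|[L [L0 psiL]]].
  rewrite inE /= /finite_norm normE => fin.
  have := ess_sup_ge (leb R n) (abse \o (EFin \o psi)).
  case: (ess_sup _ _) fin => [l _|//|_] h.
    exists `|l|; split=> //; apply: filterS h => x /=; rewrite lee_fin => h.
    exact: le_trans h (ler_norm l).
  exists 0; split=> //; apply: filterS h => x /=.
  by rewrite leeNy_eq.
apply/andP; split; first by rewrite inE.
rewrite inE /= /finite_norm normE.
apply: (@le_lt_trans _ _ L%:E); last exact: ltry.
by apply/ess_supP; apply: filterS psiL => x /=; rewrite lee_fin.
Qed.

Unset Implicit Arguments.

Theorem proposition3p2 (R : realType) (n : nat) (hn : (3 <= n)%N)
  (V : Rn R n -> R)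
  (V_ge0 : forall x, 0 <= V x)
  (V_loc : loc_integrable V)
  (V_neq0 : ~ {ae leb R n, forall x, V x = 0})
  (q : R) (hq : n%:R / 2 <= q) (V_RH : reverse_holder q V)
  (psi : Rn R n -> R) (psi_meas : measurable_fun [set: Rn R n] psi) :
  (bounded_on_bmo V 0 (multiplier psi) <->
     psi \in Lfun (leb R n) +oo%E /\
     exists C : R, 0 < C /\
       forall (x0 : Rn R n) (s : R), 0 < s -> s < critical_radius V x0 / 2 ->
         ((ln (critical_radius V x0 / s))%:E * osc (eball x0 s) psi <= C%:E)%E)
  /\
  (forall alpha : R, 0 < alpha -> alpha < 1 ->
   (bounded_on_bmo V alpha (multiplier psi) <->
     psi \in Lfun (leb R n) +oo%E /\
     exists C : R, 0 < C /\
       forall (x0 : Rn R n) (s : R), 0 < s -> s < critical_radius V x0 / 2 ->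
         (((critical_radius V x0 / s) `^ alpha)%:E * osc (eball x0 s) psi
            <= C%:E)%E)).
Proof.
have n0 : (0 < n)%N by exact: leq_trans hn.
have V_int := (locintP V).1 V_loc.
have rho_lb := critical_radius_lb hn V_ge0 V_int V_neq0 hq V_RH.
have rho_clear := critical_radius_clear hn V_ge0 V_int V_neq0 hq V_RH.
split=> [|alpha alpha0 alpha1].
  split=> [bT|[psiL [C [C0 oscC]]]].
    have [L [L0 psiL]] := multiplier_ess_bounded n0 psi_meas (lexx 0) ler01 rho_lb bT.
    have Ipsi := locint_bounded psi_meas psiL.
    split; first by apply/(LfunyP n0 psi_meas); exists L.
    have [C [C0 HC]] := log_osc n0 psi_meas rho_clear L0 psiL bT.
    exists C; split=> // x0 s s0 sx.
    by rewrite oscE// -EFinM lee_fin; exact: HC.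
  have [L [L0 {}psiL]] := (LfunyP n0 psi_meas).1 psiL.
  have Ipsi := locint_bounded psi_meas psiL.
  have [K [K0 gain]] := log_gain V.
  apply: (multiplier_bounded n0 (lexx 0) ler01
    (G := fun x s => ln (critical_radius V x / s)) psi_meas psiL L0 K0 (ltW C0)).
    move=> x s s0 sx; rewrite -lee_fin EFinM -oscE//; exact: oscC.
  exact: gain.
have a0 := ltW alpha0; have a1 := ltW alpha1.
split=> [bT|[psiL [C [C0 oscC]]]].
  have [L [L0 psiL]] := multiplier_ess_bounded n0 psi_meas a0 a1 rho_lb bT.
  have Ipsi := locint_bounded psi_meas psiL.
  split; first by apply/(LfunyP n0 psi_meas); exists L.
  have [C [C0 HC]] := power_osc n0 psi_meas rho_clear a0 a1 L0 psiL bT.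
  exists C; split=> // x0 s s0 sx.
  by rewrite oscE// -EFinM lee_fin; exact: HC.
have [L [L0 {}psiL]] := (LfunyP n0 psi_meas).1 psiL.
have Ipsi := locint_bounded psi_meas psiL.
have [K [K0 gain]] := power_gain V alpha0 a1.
apply: (multiplier_bounded n0 a0 a1
  (G := fun x s => (critical_radius V x / s) `^ alpha)
  psi_meas psiL L0 K0 (ltW C0)).
  move=> x s s0 sx; rewrite -lee_fin EFinM -oscE//; exact: oscC.
exact: gain.
Qed.
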